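(* Let $H\in(\frac12,1)$, $d\ge1$, $k\ge1$, $T\in[0,\infty)$ and $0\le s<t\le T$. Let $I=(i_1,\dots,i_{2k})$ be a word with $i_l\in\{1,\dots,d\}$ for $l=1,\dots,2k$. Then $$\mathbb{E}\left(\int_{\Delta^{2k}[s,t]}dB^{I}\right)\le\frac{(t-s)^{2kH}}{k!\,2^{k}}.$$
   Context: $B=(B^1,\dots,B^d)$ is a $d$-dimensional fractional Brownian motion with Hurst parameter $H$: its components are independent copies of the continuous centered Gaussian process with covariance $\mathbb{E}[B^i_aB^i_b]=\frac12(a^{2H}+b^{2H}-|a-b|^{2H})$, $a,b\ge0$. The simplex is $\Delta^{n}[s,t]=\{(r_1,\dots,r_n)\in[s,t]^n: r_1<\dots<r_n\}$, and for a word $I=(i_1,\dots,i_n)\in\{1,\dots,d\}^n$, $\int_{\Delta^{n}[s,t]}dB^{I}:=\int_{s\le r_1<\dots<r_n\le t}dB^{i_1}_{r_1}\cdots dB^{i_n}_{r_n}$ as an iterated Young integral. *)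

(* Defs.v *)
From HB Require Import structures.
From mathcomp Require Import all_boot all_order all_algebra.
From mathcomp Require Import all_classical all_reals all_analysis.

Set Implicit Arguments.
Unset Strict Implicit.
Unset Printing Implicit Defensive.

Import Order.TTheory GRing.Theory Num.Theory.
Import numFieldNormedType.Exports.

Local Open Scope classical_set_scope.
Local Open Scope ring_scope.

(* The degenerate case is treated apart: Gaussian processes may have
   deterministic margins, and the library's [normal_prob m 0] is the uniform
   law on [0, 1], not the Dirac mass at [m]. *)
Definition gaussian_law (R : realType) (m s : R) (U : set R) : \bar R :=
  if s == 0 then \d_m U else normal_prob m s U.

Definition gaussian (d : measure_display) (Om : measurableType d)
    (R : realType) (P : probability Om R) (X : Om -> R) : Prop :=
  exists m s : R, forall U : set R, measurable U ->
    P (X @^-1` U) = gaussian_law m s U.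

(* Processes are indexed by [R]; only the times [0 <= a] are constrained. *)
Definition gaussian_process (d : measure_display) (Om : measurableType d)
    (R : realType) (P : probability Om R) (X : R -> {RV P >-> R}) : Prop :=
  forall (n : nat) (a c : 'I_n -> R), (forall j, 0 <= a j) ->
    gaussian P (fun w => \sum_(j < n) c j * X (a j) w).

Definition process_sigma_algebra (d : measure_display) (Om : measurableType d)
    (R : realType) (P : probability Om R) (X : R -> {RV P >-> R}) :
    set (set Om) :=
  <<s [set A | exists a : R, exists U : set R,
         [/\ 0 <= a, measurable U & A = X a @^-1` U]] >>.

Definition independent_processes (d : measure_display)
    (Om : measurableType d) (R : realType) (P : probability Om R) (n : nat)
    (X : 'I_n -> R -> {RV P >-> R}) : Prop :=
  forall (J : {set 'I_n}) (A : 'I_n -> set Om),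
    (forall i, i \in J -> process_sigma_algebra (X i) (A i)) ->
    P (\bigcap_(i in [set` J]) A i) = (\prod_(i in J) P (A i))%E.

Record fbm1 (d : measure_display) (Om : measurableType d) (R : realType)
    (P : probability Om R) (H : R) (X : R -> {RV P >-> R}) : Prop := Fbm1 {
  fbm1_continuous :
    forall w : Om, {within `[0, +oo[%classic, continuous (fun a => X a w)} ;
  fbm1_gaussian : gaussian_process X ;
  fbm1_centered : forall a : R, 0 <= a -> ('E_P[X a] = 0)%E ;
  fbm1_covariance : forall a b : R, 0 <= a -> 0 <= b ->
    ('E_P[(fun w => X a w * X b w)%R] =
      (2^-1 * (a `^ (2 * H) + b `^ (2 * H) - `|a - b| `^ (2 * H)))%R%:E)%E }.

Definition fbm (d : measure_display) (Om : measurableType d) (R : realType)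
    (P : probability Om R) (n : nat) (H : R)
    (B : 'I_n -> R -> {RV P >-> R}) : Prop :=
  (forall i, fbm1 H (B i)) /\ independent_processes B.

(* The points of the partition are [a :: p], as in [itv_partition a b p];
   [xi j] is the tag of the [j]-th subinterval. *)
Definition riemann_sum (R : realType) (f g : R -> R) (a : R) (p : seq R)
    (xi : nat -> R) : R :=
  \sum_(j < size p) f (xi j) * (g (nth 0 p j) - g (nth 0 (a :: p) j)).

Definition is_young_integral (R : realType) (f g : R -> R) (a b l : R) : Prop :=
  forall e : R, 0 < e -> exists2 delta : R, 0 < delta &
    forall (p : seq R) (xi : nat -> R), itv_partition a b p ->
      (forall j, (j < size p)%N ->
         nth 0 p j - nth 0 (a :: p) j < delta /\
         nth 0 (a :: p) j <= xi j <= nth 0 p j) ->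
      `|riemann_sum f g a p xi - l| < e.

(* The limit of the Riemann-Stieltjes sums as the mesh tends to 0; the value
   is 0 when there is no limit. Almost every path of a fractional Brownian
   motion with Hurst parameter H > 1/2 is locally Hoelder continuous of some
   exponent > 1/2, so that, by Young's theorem, the limits used below exist
   almost surely. *)
Definition young_integral (R : realType) (f g : R -> R) (a b : R) : R :=
  xget 0 [set l | is_young_integral f g a b l].

(* The integral over s <= r_1 < ... < r_n <= t of d x^{i_1}_{r_1} ...
   d x^{i_n}_{r_n} for the word [I = i_1 ... i_n]: the innermost integration
   is the one against the first letter. *)
Definition iterated_integral (R : realType) (n : nat) (x : 'I_n -> R -> R)
    (s t : R) (I : seq 'I_n) : R :=
  foldl (fun (F : R -> R) i => fun r : R => young_integral F (x i) s r)
    (fun=> 1) I t.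

(* Main.v *)
(* Replace the iterated integral by the iterated left-point sums on the dyadic
   grids of [s, t].  By Wick's formula the expectation of a product of
   increments is a sum over pairings of products of covariances.  As H > 1/2,
   the increments of one component over the grid intervals are nonnegatively
   correlated, while distinct components are uncorrelated; hence the expectation
   does not decrease when all the letters are replaced by a single one.  For a
   single letter, the left-point sum of order 2k is dominated, monomial by
   monomial, by (B_t - B_s)^(2k) / (2k)!, whose expectation is
   (t - s)^(2kH) / (k! 2^k).  The same comparison bounds the second moments of
   the left-point sums uniformly in the grid, and the sums converge almost
   surely by Young's theory, the paths being almost surely Hoelder continuous of
   an exponent larger than 1/2; so the bound passes to the limit. *)

Require Import Defs.
From mathcomp Require Import all_boot all_order all_algebra.
From mathcomp Require Import all_classical all_reals all_analysis.
From mathcomp Require Import measurable_realfun ring lra.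

Set Implicit Arguments.
Unset Strict Implicit.
Unset Printing Implicit Defensive.

Import Order.TTheory GRing.Theory Num.Theory.
Import numFieldNormedType.Exports.

Local Open Scope classical_set_scope.
Local Open Scope ring_scope.

(** * Sums over partitions and the sewing bound *)

(** Two obstacles shape the proof. The convergence of the left-point sums has to survive iteration:
    the error made at one level is part of the integrand of the next and is summed against a path
    that need not have bounded variation, so a uniform bound on it does not suffice. The error is
    therefore measured on the grid in a Hoelder seminorm, and one sewing estimate serves both the
    integrals and their discretizations. Next, an explicit expansion of the left-point sums into
    monomials is avoided: domination is a relation between random variables, tested against all
    monomials in the increments and stable under sums and products, so that an induction over the
    word suffices. Wick's formula is obtained by polarization: a product is an alternating sum of
    powers of subset sums, whose moments are read off moment generating functions, the only form in
    which Gaussianity is used. The Hoelder bounds on the paths come from dyadic chaining and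
    Gaussian moments of high order. *)

Lemma powR_le (R : realType) (x y r : R) :
  0 <= r -> 0 <= x -> x <= y -> x `^ r <= y `^ r.
Proof. by move=> r0 x0 xy; apply: ge0_ler_powR => //; rewrite nnegrE ?(le_trans x0). Qed.

Lemma powRD_gt0 (R : realType) (x r s : R) :
  0 < r -> 0 < s -> x `^ (r + s) = x `^ r * x `^ s.
Proof. by move=> r0 s0; rewrite powRD// gt_eqF ?addr_gt0. Qed.

Lemma powR_le_split (R : realType) (x y r s : R) :
  0 < r -> r <= s -> 0 <= x -> x <= y -> x `^ s <= y `^ (s - r) * x `^ r.
Proof.
move=> r0 rs x0 xy; have [<-|rs'] := eqVneq r s.
  by rewrite subrr powRr0 mul1r.
have sr : 0 < s - r by rewrite subr_gt0 lt_neqAle rs'.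
have -> : x `^ s = x `^ (s - r) * x `^ r by rewrite -powRD_gt0// subrK.
rewrite ler_wpM2r ?powR_ge0//.
by apply: powR_le => //; exact: ltW.
Qed.

Lemma powR_half_lt (R : realType) (r : R) : 1 < r -> 2 * 2^-1 `^ r < 1 :> R.
Proof.
move=> r1; have -> : (2^-1 : R) `^ r = 2^-1 `^ (r - 1) * 2^-1 `^ 1.
  by rewrite -powRD_gt0 ?subr_gt0// subrK.
rewrite powRr1 ?invr_ge0// mulrCA divff// mulr1.
have : (2^-1 : R) `^ (r - 1) < 1 `^ (r - 1).
  by apply: gt0_ltr_powR; rewrite ?nnegrE ?subr_gt0// invf_lt1// ltr1n.
by rewrite powR1.
Qed.

Lemma powR_half_expr (R : realType) (r : R) n :
  (2 ^+ n)^-1 `^ r = (2^-1 `^ r) ^+ n.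
Proof.
rewrite -exprVn -[LHS]/(powR _ r) -(powR_mulrn n) ?invr_ge0// -powRrM mulrC.
by rewrite powRrM powR_mulrn ?powR_ge0.
Qed.

Lemma cvg_powR_half (R : realType) (x r : R) : 0 <= x -> 0 < r ->
  (fun n => (x / 2 ^+ n) `^ r) @ \oo --> (0 : R).
Proof.
move=> x0 r0.
have -> : (fun n => (x / 2 ^+ n) `^ r) = geometric (x `^ r) (2^-1 `^ r).
  apply/funext => n /=; rewrite powRM// ?invr_ge0 ?exprn_ge0//; congr (_ * _);
    exact: powR_half_expr.
apply: cvg_geometric; rewrite ger0_norm ?powR_ge0//.
have : (2^-1 : R) `^ r < 1 `^ r.
  by apply: gt0_ltr_powR; rewrite ?nnegrE// invf_lt1// ltr1n.
by rewrite powR1.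
Qed.

Section partition_sums.
Variables (R : realType) (T : eqType) (tau : T -> R).
Implicit Types (Xi : T -> T -> R) (a : T) (p : seq T).

(** The points have an arbitrary type [T], because the sewing bound is applied both to real points,
    with [tau := id], and to the indices of a dyadic grid. *)
Fixpoint psum Xi a p := if p is x :: p' then Xi a x + psum Xi x p' else 0.

Lemma psum_cat Xi a p q :
  psum Xi a (p ++ q) = psum Xi a p + psum Xi (last a p) q.
Proof. by elim: p a => [|x p IH] a /=; rewrite ?add0r// IH addrA. Qed.

Lemma psum_norm_le Xi Yi a p (D : pred T) (ltT : rel T) :
  {in D &, forall x y, ltT x y -> `|Xi x y| <= Yi x y} ->
  all D (a :: p) -> path ltT a p -> `|psum Xi a p| <= psum Yi a p.
Proof.
move=> XY; elim: p a => [|x p IH] a /=; first by rewrite normr0.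
move=> /and3P[Da Dx Dp] /andP[ax pp].
rewrite (le_trans (ler_normD _ _))// lerD// ?XY// IH//=.
by rewrite Dx.
Qed.

Lemma psumB Xi Yi a p :
  psum (fun x y => Xi x y - Yi x y) a p = psum Xi a p - psum Yi a p.
Proof. by elim: p a => [|x p IH] a /=; rewrite ?subr0// IH; ring. Qed.

Lemma psumZ c Xi a p : psum (fun x y => c * Xi x y) a p = c * psum Xi a p.
Proof. by elim: p a => [|x p IH] a /=; rewrite ?mulr0// IH mulrDr. Qed.

Lemma psum_telescope (F : T -> R) a p :
  psum (fun x y => F y - F x) a p = F (last a p) - F a.
Proof. by elim: p a => [|x p IH] a /=; rewrite ?subrr// IH; ring. Qed.

(* Locked, lest [mulr_ge0] unfold it to a quotient. *)
Fact sewing_cst_key : unit. Proof. exact: tt. Qed.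
Definition sewing_cst (th : R) : R :=
  locked_with sewing_cst_key (2 / (1 - 2 * 2^-1 `^ th)).

Lemma sewing_cst_ge0 th : 1 < th -> 0 <= sewing_cst th.
Proof. by move=> /powR_half_lt th1; rewrite [sewing_cst th]unlock divr_ge0// subr_ge0 ltW. Qed.

(** The recursion behind [sewing_bound]: two pieces of at most half the length cost
    [sewing_cst th * 2^-1 ^ th] each, and two defects cost 1 each. *)
Lemma sewing_cstE th : 1 < th ->
  sewing_cst th * (2 * 2^-1 `^ th) + 2 = sewing_cst th.
Proof.
move=> /powR_half_lt th1; rewrite [sewing_cst th]unlock.
have : 1 - 2 * 2^-1 `^ th != 0 by rewrite gt_eqF// subr_gt0.
by set u := 2^-1 `^ th => u0; field.
Qed.

Let lt_tau : rel T := fun x y => tau x < tau y.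

Lemma path_tau_le a p : path lt_tau a p -> tau a <= tau (last a p).
Proof.
by elim: p a => [//|x p IH] a /= /andP[ax /IH]; apply: le_trans; exact: ltW.
Qed.

Lemma split_at_level a p (c : R) : path lt_tau a p -> tau a <= c ->
    c < tau (last a p) ->
  exists p1 y p2, [/\ p = p1 ++ y :: p2, tau (last a p1) <= c & c < tau y].
Proof.
elim: p a => [|x p IH] a /=; first by rewrite leNgt => _ /negbTE ->.
move=> /andP[ax pp] ac cl; have [xc|cx] := leP (tau x) c.
  have [p1 [y [p2 [-> h1 h2]]]] := IH _ pp xc cl.
  by exists (x :: p1), y, p2.
by exists [::], x, p.
Qed.

(* Instead of removing partition points one at a time as in Young's proof,
   split the partition at the interval that contains the midpoint: both
   remaining pieces are at most half as long, and the errors decrease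
   geometrically. *)
Lemma sewing_bound Xi (D : pred T) (C th : R) a p :
  1 < th -> 0 <= C ->
  (forall x, Xi x x = 0) ->
  {in D & &, forall x y z, tau x <= tau y <= tau z ->
    `|Xi x z - Xi x y - Xi y z| <= C * (tau z - tau x) `^ th} ->
  all D (a :: p) -> path lt_tau a p ->
  `|psum Xi a p - Xi a (last a p)| <=
    sewing_cst th * C * (tau (last a p) - tau a) `^ th.
Proof.
move=> th1 C0 Xixx HXi; have K0 := sewing_cst_ge0 th1.
have [n] := ubnP (size p); elim: n a p => // n IH a [|x p] sp Dap pap /=.
  by rewrite Xixx subr0 normr0 mulr_ge0 ?powR_ge0// mulr_ge0.
set b := last x p.
have ab : tau a < tau b.
  by move: pap => /= /andP[ax /path_tau_le]; exact: lt_le_trans.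
have [||p1 [y [p2 [pE h1 h2]]]] := @split_at_level a (x :: p)
    (2^-1 * (tau a + tau b)) pap; rewrite -?/b.
- lra.
- by rewrite /= -/b; lra.
set m := last a p1 in h1.
have bE : b = last y p2 by rewrite -[b]/(last a (x :: p)) pE last_cat.
rewrite [_ + psum _ _ _](_ : _ = psum Xi a (x :: p))// pE psum_cat /= -/m.
move: pap; rewrite pE cat_path /= -/m => /and3P[pp1 my pp2].
move: Dap; rewrite pE /= all_cat /= => /and4P[Da Dp1 Dy Dp2].
have Dm : m \in D by have := mem_last a p1; rewrite inE -/m => /predU1P[->//|/(allP Dp1)].
have Db : b \in D.
  by rewrite bE; have := mem_last y p2; rewrite inE => /predU1P[->//|/(allP Dp2)].
have am : tau a <= tau m by exact: path_tau_le.
have {}my : tau m < tau y by [].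
have yb : tau y <= tau b by rewrite bE; exact: path_tau_le.
have sz : (size p1 + size p2 < n)%N.
  by move: sp; rewrite pE size_cat /= addnS ltnS.
have I1 := IH a p1 (leq_ltn_trans (leq_addr _ _) sz) _ pp1.
have I2 := IH y p2 (leq_ltn_trans (leq_addl _ _) sz) _ pp2.
have {}I1 := I1 _; rewrite -/m in I1; rewrite -bE in I2.
have {}I1 : `|psum Xi a p1 - Xi a m| <= sewing_cst th * C * (tau m - tau a) `^ th.
  by apply: I1; rewrite /= Da.
have {}I2 : `|psum Xi y p2 - Xi y b| <= sewing_cst th * C * (tau b - tau y) `^ th.
  by apply: I2; rewrite /= Dy.
set L := tau b - tau a.
have half d : 0 <= d -> d <= 2^-1 * L -> d `^ th <= 2^-1 `^ th * L `^ th.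
  move=> d0 dL; rewrite -powRM ?invr_ge0//; last by rewrite subr_ge0 ltW.
  by apply: powR_le => //; lra.
have e1 : (tau m - tau a) `^ th <= 2^-1 `^ th * L `^ th.
  by apply: half; rewrite /L; lra.
have e2 : (tau b - tau y) `^ th <= 2^-1 `^ th * L `^ th.
  by apply: half; rewrite /L; lra.
have mb : tau m <= tau b by apply: ltW; exact: lt_le_trans yb.
have d1 : `|Xi a b - Xi a m - Xi m b| <= C * L `^ th.
  by apply: HXi => //; rewrite am.
have d2 : `|Xi m b - Xi m y - Xi y b| <= C * L `^ th.
  apply: le_trans (HXi _ _ _ Dm Dy Db _) _; first by rewrite (ltW my).
  by rewrite ler_wpM2l// powR_le//; rewrite /L; lra.
(* The middle interval contributes exactly [Xi m y], so only two defects arise: from inserting [m]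
   between [a] and [b], then [y] between [m] and [b]. *)
rewrite [X in `|X|](_ : _ = (psum Xi a p1 - Xi a m) + (psum Xi y p2 - Xi y b)
   - (Xi a b - Xi a m - Xi m b) - (Xi m b - Xi m y - Xi y b)); last by ring.
apply: le_trans (ler_normB _ _) _; apply: le_trans (lerD (ler_normB _ _) d2) _.
apply: le_trans (lerD (lerD (ler_normD _ _) d1) (lexx _)) _.
have KC : 0 <= sewing_cst th * C by rewrite mulr_ge0.
have f1 := le_trans I1 (ler_wpM2l KC e1).
have f2 := le_trans I2 (ler_wpM2l KC e2).
rewrite -[in leRHS](sewing_cstE th1).
rewrite -/L; move: f1 f2.
set v := L `^ th; set h := 2^-1 `^ th; set K := sewing_cst th.
set n1 := `|_|; set n2 := `|_| => f1 f2.
have -> : (K * (2 * h) + 2) * C * v =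
    K * C * (h * v) + K * C * (h * v) + C * v + C * v by ring.
by rewrite !lerD.
Qed.

End partition_sums.

Section real_partitions.
Variable R : realType.
Implicit Types (a b : R) (p q : seq R).

Lemma lt_path_le_last a p z : path <%R a p -> z \in a :: p -> z <= last a p.
Proof.
elim: p a z => [|x p IH] a z /=; first by rewrite inE => _ /eqP ->.
move=> /andP[ax xp]; rewrite inE => /predU1P[->|]; last exact: IH.
by apply: le_trans (ltW ax) _; apply: IH; rewrite ?inE ?eqxx.
Qed.

Lemma lt_path_ge_head a p z : path <%R a p -> z \in a :: p -> a <= z.
Proof.
move=> ap; rewrite inE => /predU1P[->//|zp].
by have /allP/(_ _ zp)/ltW := order_path_min lt_trans ap.
Qed.

Lemma lt_path_last_nil a p : path <%R a p -> last a p = a -> p = [::].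
Proof.
case: p => //= x p /andP[ax xp] xa.
by have := lt_path_le_last xp (mem_head x p); rewrite xa leNgt ax.
Qed.

Lemma common_refinement a b p q : itv_partition a b p -> itv_partition a b q ->
  exists r, [/\ itv_partition a b r, {subset p <= r} & {subset q <= r}].
Proof.
move=> [ap /eqP pb] [aq /eqP qb].
pose r := sort <=%R (undup (p ++ q)).
have rE z : (z \in r) = (z \in p) || (z \in q).
  by rewrite mem_sort mem_undup mem_cat.
have ar : path <%R a r.
  rewrite lt_path_sortedE; apply/andP; split.
    apply/allP => z; rewrite rE.
    by case/orP; [move: ap|move: aq] => /(order_path_min lt_trans)/allP; apply.
  by rewrite lt_sorted_uniq_le sort_uniq undup_uniq sort_le_sorted.
exists r; split; [split=> //|by move=> z; rewrite rE => ->|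
  by move=> z zq; rewrite rE zq orbT].
rewrite eq_le; apply/andP; split.
  have := mem_last a r; rewrite inE rE => /or3P[/eqP->|zp|zq].
  - by rewrite -pb; apply: lt_path_le_last; rewrite ?mem_head.
  - by rewrite -pb; apply: lt_path_le_last; rewrite // inE zp orbT.
  - by rewrite -qb; apply: lt_path_le_last; rewrite // inE zq orbT.
apply: lt_path_le_last => //; rewrite inE rE -{1}pb.
by have := mem_last a p; rewrite inE pb => /predU1P[->|->]; rewrite ?eqxx ?orbT.
Qed.

(** The points of [q] inside one interval of [p] partition that interval, so the sewing bound
    applies interval by interval and the errors add up. *)
Lemma refinement_bound (Xi : R -> R -> R) (D : pred R) (C th : R) a p q :
  1 < th -> 0 <= C -> (forall x, Xi x x = 0) ->
  {in D & &, forall x y z, x <= y <= z ->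
    `|Xi x z - Xi x y - Xi y z| <= C * (z - x) `^ th} ->
  path <%R a p -> path <%R a q -> last a p = last a q -> {subset p <= q} ->
  all D (a :: q) ->
  `|psum Xi a q - psum Xi a p| <=
    sewing_cst th * C * psum (fun u v => (v - u) `^ th) a p.
Proof.
move=> th1 C0 Xi0 HXi; elim: p a q => [|x p IH] a q.
  move=> _ aq /= /esym/(lt_path_last_nil aq) -> _ _.
  by rewrite subrr normr0 mulr0.
move=> /= /andP[ax xp] aq pq sub.
have xq : x \in q by apply: sub; rewrite mem_head.
case/path.splitP: xq aq pq sub => q1 q2.
rewrite cat_path last_cat last_rcons => /andP[aq1 xq2] pq sub.
rewrite all_cat => /and3P[Da Dq1' Dq2].
have Dq1 : all D (a :: rcons q1 x) by rewrite /= Da.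
have Dx : D x by move: Dq1 => /= /andP[_]; rewrite all_rcons => /andP[].
have sub2 : {subset p <= q2}.
  move=> z zp; have xz : x < z by have /allP/(_ _ zp) := order_path_min lt_trans xp.
  have := sub z; rewrite inE zp orbT mem_cat => /(_ isT)/orP[|//].
  move=> zq1; have := lt_path_le_last (z := z) aq1.
  by rewrite last_rcons inE zq1 orbT leNgt xz => /(_ isT).
have I2 := IH x q2 xp xq2 pq sub2 _.
have {}I2 := I2 _; have {}I2 : `|psum Xi x q2 - psum Xi x p| <=
    sewing_cst th * C * psum (fun u v => (v - u) `^ th) x p.
  by apply: I2; rewrite /= Dx.
have I1 := @sewing_bound R R id Xi D C th a (rcons q1 x) th1 C0 Xi0 HXi Dq1 aq1.
rewrite last_rcons in I1.
rewrite psum_cat last_rcons /= opprD addrACA mulrDr.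
by apply: le_trans (ler_normD _ _) _; rewrite lerD.
Qed.

(** Turns the error sums of the sewing estimates into a power of the mesh, which tends to 0 when
    [th] exceeds 1. *)
Lemma psum_powR_mesh (th d : R) a p : 1 <= th -> 0 <= d ->
  path <%R a p -> path (fun u v => v - u <= d) a p ->
  psum (fun u v => (v - u) `^ th) a p <= d `^ (th - 1) * (last a p - a).
Proof.
move=> th1 d0; elim: p a => [|x p IH] a /=; first by rewrite subrr mulr0.
move=> /andP[ax xp] /andP[axd xpd].
have -> : last x p - a = (x - a) + (last x p - x) by ring.
rewrite mulrDr lerD ?IH//.
have := @powR_le_split R (x - a) d 1 th; rewrite powRr1; last by rewrite subr_ge0 ltW.
by apply=> //; rewrite subr_ge0 ltW.
Qed.

Definition dyadic_grid a b n : seq R :=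
  [seq a + j%:R * ((b - a) / 2 ^+ n) | j <- iota 1 (2 ^ n)].

Lemma dyadic_gridP a b n : a < b ->
  itv_partition a b (dyadic_grid a b n) /\
  path (fun u v => v - u <= (b - a) / 2 ^+ n) a (dyadic_grid a b n).
Proof.
move=> ab; set h := (b - a) / 2 ^+ n.
have h0 : 0 < h by rewrite divr_gt0 ?subr_gt0// exprn_gt0.
have key m k : path <%R (a + m%:R * h) [seq a + j%:R * h | j <- iota m.+1 k] /\
    path (fun u v => v - u <= h) (a + m%:R * h) [seq a + j%:R * h | j <- iota m.+1 k]
    /\ last (a + m%:R * h) [seq a + j%:R * h | j <- iota m.+1 k] = a + (m + k)%:R * h.
  elim: k m => [|k IH] m /=; first by rewrite addn0.
  have [-> [-> ->]] := IH m.+1.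
  rewrite addSnnS; split; [|split=> //]; rewrite andbT -natr1; lra.
have := key 0%N (2 ^ n)%N; rewrite mul0r addr0 add0n => -[k1 [k2 k3]].
split=> //; split=> //; apply/eqP; rewrite k3 /h natrX mulrC divfK; first ring.
by rewrite expf_neq0.
Qed.

Lemma partition_mesh_exists a b (d : R) : a <= b -> 0 < d ->
  exists p, itv_partition a b p /\ path (fun u v => v - u < d) a p.
Proof.
rewrite le_eqVlt => /predU1P[<-|ab] d0; first by exists [::].
have := @cvg_powR_half R (b - a) 1 _ ltr01; rewrite subr_ge0 (ltW ab) => /(_ isT).
move=> /cvgrPdist_lt/(_ _ d0)[n _ /(_ n (leqnn n))] /=.
rewrite sub0r normrN powRr1; last by rewrite divr_ge0 ?subr_ge0 ?exprn_ge0// ltW.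
rewrite ger0_norm; last by rewrite divr_ge0 ?subr_ge0 ?exprn_ge0// ltW.
move=> hd; have [gP gm] := dyadic_gridP n ab; exists (dyadic_grid a b n); split=> //.
by apply: sub_path gm => u v /le_lt_trans; apply.
Qed.

End real_partitions.

(** * Young integrals *)

Definition hoelder_on (R : realType) (al L a b : R) (f : R -> R) :=
  forall u v, a <= u -> u <= v -> v <= b -> `|f v - f u| <= L * (v - u) `^ al.

Section young.
Variables (R : realType) (al : R).
Hypothesis al_gt : 2^-1 < al.
Implicit Types (f x : R -> R) (a b L A : R).

Let th := al + al.
Let th1 : 1 < th. Proof. move: al_gt; rewrite /th => h; lra. Qed.
Let al0 : 0 < al. Proof. by apply: lt_trans al_gt; rewrite invr_gt0. Qed.

Definition young_germ f x u v : R := f u * (x v - x u).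

Definition young_cst : R := sewing_cst th.

Lemma young_cst_ge0 : 0 <= young_cst. Proof. exact: sewing_cst_ge0. Qed.

(** The defect of the germ factors into an increment of [f] times an increment of [x]; this is where
    the two exponents add up to [th], which exceeds 1. *)
Lemma young_germ_delta f x L A a b : 0 <= L -> 0 <= A ->
  hoelder_on al L a b f -> hoelder_on al A a b x ->
  {in [pred z | a <= z <= b] & &, forall u v w, u <= v <= w ->
    `|young_germ f x u w - young_germ f x u v - young_germ f x v w|
      <= L * A * (w - u) `^ th}.
Proof.
move=> L0 A0 hf hx u v w /andP[au _] /andP[av vb] /andP[_ wb] /andP[uv vw].
rewrite /young_germ [X in `|X|](_ : _ = - ((f v - f u) * (x w - x v))); last ring.
rewrite normrN normrM /th powRD_gt0// mulrACA.
apply: ler_pM => //.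
- apply: le_trans (hf _ _ au uv vb) _; rewrite ler_wpM2l// powR_le ?(ltW al0)//; lra.
- apply: le_trans (hx _ _ av vw wb) _; rewrite ler_wpM2l// powR_le ?(ltW al0)//; lra.
Qed.

Lemma young_germ_refl f x u : young_germ f x u u = 0.
Proof. by rewrite /young_germ subrr mulr0. Qed.

Lemma partition_all_itv a b (p : seq R) :
  itv_partition a b p -> all [pred z | a <= z <= b] (a :: p).
Proof.
move=> [ap /eqP pb]; apply/allP => z zp /=.
by rewrite (lt_path_ge_head ap)//= -pb; exact: lt_path_le_last.
Qed.

Lemma young_sum_bound f x L A a b p : 0 <= L -> 0 <= A ->
  hoelder_on al L a b f -> hoelder_on al A a b x -> itv_partition a b p ->
  `|psum (young_germ f x) a p - young_germ f x a b| <=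
     young_cst * (L * A) * (b - a) `^ th.
Proof.
move=> L0 A0 hf hx pP; have Dp := partition_all_itv pP.
case: pP => ap /eqP pb.
have := sewing_bound (tau := id) th1 (mulr_ge0 L0 A0) (young_germ_refl f x)
  (young_germ_delta L0 A0 hf hx) Dp ap.
by rewrite pb.
Qed.

Lemma young_sum_refine f x L A a b p q : 0 <= L -> 0 <= A ->
  hoelder_on al L a b f -> hoelder_on al A a b x ->
  itv_partition a b p -> itv_partition a b q -> {subset p <= q} ->
  `|psum (young_germ f x) a q - psum (young_germ f x) a p| <=
     young_cst * (L * A) * psum (fun u v => (v - u) `^ th) a p.
Proof.
move=> L0 A0 hf hx [ap /eqP pb] qP pq; have Dq := partition_all_itv qP.
case: qP => aq /eqP qb.
apply: (refinement_bound th1 (mulr_ge0 L0 A0) (young_germ_refl f x)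
  (young_germ_delta L0 A0 hf hx)) => //.
by rewrite pb.
Qed.

Lemma young_sum_diff f x L A a b p q : 0 <= L -> 0 <= A ->
  hoelder_on al L a b f -> hoelder_on al A a b x ->
  itv_partition a b p -> itv_partition a b q ->
  `|psum (young_germ f x) a p - psum (young_germ f x) a q| <=
     young_cst * (L * A) * psum (fun u v => (v - u) `^ th) a p +
     young_cst * (L * A) * psum (fun u v => (v - u) `^ th) a q.
Proof.
move=> L0 A0 hf hx pP qP; have [r [rP pr qr]] := common_refinement pP qP.
rewrite -(subrKA (psum (young_germ f x) a r)).
apply: le_trans (ler_normD _ _) _; rewrite lerD//.
- by rewrite distrC; exact: (young_sum_refine (b := b)).
- exact: (young_sum_refine (b := b)).
Qed.

(** Moving a tag to the left end of its interval changes one term by a product of two Hoelder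
    increments. The starting point [c] varies in the induction, while the Hoelder bounds stay on
    [[a, b]]. *)
Lemma riemann_sum_psum f x L A a b p xi : 0 <= L -> 0 <= A ->
  hoelder_on al L a b f -> hoelder_on al A a b x ->
  all [pred z | a <= z <= b] p ->
  forall c, a <= c <= b -> path <%R c p ->
  (forall j, (j < size p)%N -> nth 0 (c :: p) j <= xi j <= nth 0 p j) ->
  `|riemann_sum f x c p xi - psum (young_germ f x) c p| <=
    L * A * psum (fun u v => (v - u) `^ th) c p.
Proof.
move=> L0 A0 hf hx; elim: p xi => [|y p IH] xi /= Dp c Dc cp Hxi.
  by rewrite /riemann_sum big_ord0 subr0 normr0 mulr0.
case/andP: Dp => /andP[ay yb] Dp; case/andP: cp => cy yp.
case/andP: Dc => ac cb.
have /= /andP[x1 x2] := Hxi 0%N isT.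
have {}IH := IH (xi \o succn) Dp y _ yp _.
have {}IH : `|riemann_sum f x y p (xi \o succn) - psum (young_germ f x) y p| <=
    L * A * psum (fun u v => (v - u) `^ th) y p.
  by apply: IH; [rewrite ay | move=> j jp; apply: (Hxi j.+1)].
have -> : riemann_sum f x c (y :: p) xi =
    f (xi 0%N) * (x y - x c) + riemann_sum f x y p (xi \o succn).
  by rewrite /riemann_sum big_ord_recl /=; congr (_ + _).
rewrite opprD addrACA [in leRHS]mulrDr.
rewrite [X in `|X + _|](_ : _ = (f (xi 0%N) - f c) * (x y - x c)); last first.
  by rewrite /young_germ; ring.
apply: le_trans (ler_normD _ _) _; rewrite lerD//.
rewrite normrM /th powRD_gt0// mulrACA; apply: ler_pM => //.
- apply: le_trans (hf _ _ ac x1 _) _; first lra.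
  by rewrite ler_wpM2l// powR_le ?(ltW al0)//; lra.
- by apply: hx => //; exact: ltW.
Qed.

Lemma psum_mesh_cvg a b (d : R) p : itv_partition a b p -> 0 <= d ->
  path (fun u v => v - u <= d) a p ->
  psum (fun u v => (v - u) `^ th) a p <= d `^ (th - 1) * (b - a).
Proof.
by move=> [ap /eqP <-] d0 pd; apply: psum_powR_mesh => //; exact: ltW.
Qed.

(** The left-point sums over dyadic grids form a Cauchy sequence. Comparing an arbitrary partition
    with these grids and passing to the limit gives the second clause, which then yields the
    first. *)
Lemma young_exists f x L A a b : 0 <= L -> 0 <= A -> a <= b ->
  hoelder_on al L a b f -> hoelder_on al A a b x ->
  exists l, [/\ is_young_integral f x a b l &
    forall p, itv_partition a b p ->
      `|psum (young_germ f x) a p - l| <=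
        young_cst * (L * A) * psum (fun u v => (v - u) `^ th) a p].
Proof.
move=> L0 A0; rewrite le_eqVlt => /predU1P[<- _ _|ab hf hx].
  exists 0; split=> [e e0|p [ap /eqP/(lt_path_last_nil ap) ->] /=].
    exists 1 => // p xi [ap /eqP/(lt_path_last_nil ap) ->] _.
    by rewrite /riemann_sum big_ord0 subrr normr0.
  by rewrite subrr normr0 mulr0.
set K := young_cst * (L * A).
have K0 : 0 <= K by rewrite mulr_ge0 ?young_cst_ge0// mulr_ge0.
have ab0 : 0 <= b - a by rewrite subr_ge0 ltW.
pose g n := dyadic_grid a b n.
have gP n : itv_partition a b (g n) by case: (dyadic_gridP n ab).
pose w n : R := K * psum (fun u v => (v - u) `^ th) a (g n).
have w0 : w @ \oo --> (0 : R).
  have h0 n : 0 <= (b - a) / 2 ^+ n by rewrite divr_ge0// exprn_ge0.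
  have : (fun n => K * (b - a) * ((b - a) / 2 ^+ n) `^ (th - 1)) @ \oo --> (0 : R).
    rewrite -[X in _ --> X](mulr0 (K * (b - a))); apply: cvgMl_tmp.
    by apply: cvg_powR_half => //; rewrite subr_gt0.
  apply: (@squeeze_cvgr _ _ _ _ (cst 0)); last exact: cvg_cst.
  apply: nearW => n /=; apply/andP; split.
    rewrite mulr_ge0//; elim: (g n) (a) => //= y p IH c.
    by rewrite addr_ge0// powR_ge0.
  rewrite /w -mulrA ler_wpM2l// mulrC; apply: psum_mesh_cvg => //.
  by case: (dyadic_gridP n ab).
pose u n := psum (young_germ f x) a (g n).
have u_cv : cvgn u.
  apply/cauchy_cvgP; apply: cauchy_exP => e e0.
  have e2 : 0 < e / 2 by rewrite divr_gt0.
  move/cvgrPdist_lt : w0 => /(_ _ e2)[n _ wn].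
  exists (u n); exists n => // m /= nm.
  rewrite -ball_normE /=.
  apply: le_lt_trans (young_sum_diff L0 A0 hf hx (gP n) (gP m)) _.
  have := wn n (leqnn n); have := wn m nm; rewrite /= !sub0r !normrN.
  move=> /(le_lt_trans (ler_norm _)) h1 /(le_lt_trans (ler_norm _)) h2.
  by rewrite -/K -/(w n) -/(w m); lra.
exists (limn u).
have key p : itv_partition a b p ->
    `|psum (young_germ f x) a p - limn u| <= K * psum (fun u v => (v - u) `^ th) a p.
  move=> pP; set B := K * _.
  have c1 : (fun n => `|psum (young_germ f x) a p - u n|) @ \oo -->
     `|psum (young_germ f x) a p - limn u|.
    by apply: cvg_norm; apply: cvgB => //; exact: cvg_cst.
  have c2 : (fun n => B + w n) @ \oo --> B + 0 by apply: cvgD => //; exact: cvg_cst.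
  rewrite -(addr0 B); apply: (ler_cvg_to c1 c2); apply: nearW => n.
  exact: (young_sum_diff L0 A0 hf hx pP (gP n)).
split=> // e e0.
(* For a mesh below [d], moving the tags costs [L * A * (d ^ (th - 1) * (b - a))] and the left-point
   sum costs the same with [K]; the [+ 1] keeps the divisor positive. *)
have M0 : 0 < (K + L * A) * (b - a) + 1.
  by rewrite ltr_pwDr// mulr_ge0// addr_ge0// mulr_ge0.
have : (fun n : nat => ((b - a) / 2 ^+ n) `^ (th - 1)) @ \oo --> (0 : R).
  by apply: cvg_powR_half => //; rewrite subr_gt0.
move=> /cvgrPdist_lt/(_ (e / ((K + L * A) * (b - a) + 1))).
rewrite divr_gt0// => /(_ isT)[n _ /(_ n (leqnn n))] /=.
rewrite sub0r normrN ger0_norm ?powR_ge0//; set d := (b - a) / 2 ^+ n => dn.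
have d0 : 0 < d by rewrite divr_gt0 ?subr_gt0// exprn_gt0.
exists d => // p xi pP Hp.
have pd : path (fun u v => v - u <= d) a p.
  apply/(pathP 0) => j jp; apply: ltW; exact: (Hp j jp).1.
have s1 := psum_mesh_cvg pP (ltW d0) pd.
have := partition_all_itv pP => /= /andP[_ Dp].
have s2 := riemann_sum_psum L0 A0 hf hx Dp (c := a) _ pP.1 (fun j jp => (Hp j jp).2).
rewrite lexx (ltW ab) in s2; have {}s2 := s2 isT.
rewrite -(subrKA (psum (young_germ f x) a p)).
apply: le_lt_trans (ler_normD _ _) _.
apply: le_lt_trans (lerD s2 (key p pP)) _.
rewrite -mulrDl [_ + K]addrC.
apply: (@le_lt_trans _ _ ((K + L * A) * (d `^ (th - 1) * (b - a)))).
  by rewrite ler_wpM2l// addr_ge0// mulr_ge0.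
rewrite mulrCA; move: dn; rewrite ltr_pdivlMr//; apply: le_lt_trans.
by rewrite ler_wpM2l ?powR_ge0// lerDl.
Qed.

(** Rests on partitions of arbitrarily small mesh, without which every number would vacuously be a
    limit. *)
Lemma young_unique f x a b l l' : a <= b ->
  is_young_integral f x a b l -> is_young_integral f x a b l' -> l = l'.
Proof.
move=> ab hl hl'; apply/eqP; rewrite -subr_eq0 -normr_le0.
apply/ler_addgt0Pl => e e0; rewrite addr0.
have e2 : 0 < e / 2 by rewrite divr_gt0.
have [d d0 Hd] := hl _ e2; have [d' d'0 Hd'] := hl' _ e2.
have dd : 0 < Num.min d d' by rewrite lt_min d0.
have [p [pP pd]] := partition_mesh_exists ab dd.
have t1 j : (j < size p)%N -> nth 0 p j - nth 0 (a :: p) j < Num.min d d'.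
  by move=> jp; move/(pathP 0) : pd; apply.
have t2 j : (j < size p)%N -> nth 0 (a :: p) j <= nth 0 p j <= nth 0 p j.
  by move=> jp; rewrite lexx andbT ltW//; case: pP => /(pathP 0) + _; apply.
have := Hd p (nth 0 p) pP; have := Hd' p (nth 0 p) pP.
move=> /(_ _)/wrap[|r1 /(_ _)/wrap[|r2]].
- by move=> j jp; have := t1 j jp; rewrite lt_min => /andP[]; split=> //; exact: t2.
- by move=> j jp; have := t1 j jp; rewrite lt_min => /andP[]; split=> //; exact: t2.
rewrite -(subrKA (riemann_sum f x a p (nth 0 p))) (splitr e).
by apply: le_trans (ler_normD _ _) _; rewrite lerD// ltW// distrC.
Qed.

(** Under Hoelder bounds the value chosen by [xget] is the true limit, and it inherits the explicit
    error of the sums. *)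
Lemma young_integralP f x L A a b : 0 <= L -> 0 <= A -> a <= b ->
  hoelder_on al L a b f -> hoelder_on al A a b x ->
  forall p, itv_partition a b p ->
    `|psum (young_germ f x) a p - young_integral f x a b| <=
      young_cst * (L * A) * psum (fun u v => (v - u) `^ th) a p.
Proof.
move=> L0 A0 ab hf hx; have [l [hl hp]] := young_exists L0 A0 ab hf hx.
have -> // : young_integral f x a b = l.
apply: (young_unique ab _ hl); rewrite /young_integral.
by apply: (xgetPex (0 : R)); exists l.
Qed.

End young.

(** * Indefinite Young integrals and left-point sums on dyadic grids *)

Lemma hoelder_on_sub (R : realType) (al L a b c d : R) f : a <= c -> d <= b ->
  hoelder_on al L a b f -> hoelder_on al L c d f.
Proof.
move=> ac db hf u v cu uv vd; apply: hf => //; first exact: le_trans cu.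
exact: le_trans db.
Qed.

Section young_indefinite.
Variables (R : realType) (al : R).
Hypothesis al_gt : 2^-1 < al.
Hypothesis al_lt : al < 1.
Implicit Types (f x : R -> R) (a b L A : R).

Let th := al + al.
Let th1 : 1 < th. Proof. by move: al_gt; rewrite /th => h; lra. Qed.
Let al0 : 0 < al. Proof. by apply: lt_trans al_gt; rewrite invr_gt0. Qed.

(** Additivity of the integral is not isolated: fine partitions of [[a, u]] and [[u, v]] are
    concatenated, and the sum over the second one is already close to its germ by
    [young_sum_bound]. *)
Lemma young_increment f x L A a b u v : 0 <= L -> 0 <= A ->
  hoelder_on al L a b f -> hoelder_on al A a b x ->
  a <= u -> u <= v -> v <= b ->
  `|young_integral f x a v - young_integral f x a u - young_germ f x u v| <=
    young_cst al * (L * A) * (v - u) `^ th.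
Proof.
move=> L0 A0 hf hx au uv vb; set K := young_cst al * (L * A).
have K0 : 0 <= K by rewrite mulr_ge0 ?young_cst_ge0 ?mulr_ge0//.
have av : a <= v by exact: le_trans uv.
apply/ler_addgt0Pl => e e0.
(* The sums over [[a, v]] and [[a, u]] miss their integrals by [K * (v - a)] and [K * (u - a)] times
   a power of the mesh; the [+ 1] makes [M] positive. *)
pose M := K * ((v - a) + (u - a)) + 1.
have M0 : 0 < M by rewrite ltr_pwDr// mulr_ge0// addr_ge0// subr_ge0.
have : (fun n : nat => (1 / 2 ^+ n) `^ (th - 1)) @ \oo --> (0 : R).
  by apply: cvg_powR_half => //; rewrite subr_gt0.
move=> /cvgrPdist_lt/(_ (e / M)); rewrite divr_gt0// => /(_ isT)[n _ /(_ n (leqnn n))] /=.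
rewrite sub0r normrN ger0_norm ?powR_ge0// ltr_pdivlMr//.
set d := 1 / 2 ^+ n => dM.
have d0 : 0 < d by rewrite divr_gt0// exprn_gt0.
have [p [pP pd]] := partition_mesh_exists au d0.
have [q [qP qd]] := partition_mesh_exists uv d0.
have pqP : itv_partition a v (p ++ q) by exact: itv_partition_cat pP qP.
have lap : last a p = u by case: pP => _ /eqP.
have pqd : path (fun u v => v - u <= d) a (p ++ q).
  rewrite cat_path lap; apply/andP; split.
    by apply: sub_path pd => ? ?; exact: ltW.
  by apply: sub_path qd => ? ?; exact: ltW.
have pd' : path (fun u v => v - u <= d) a p by apply: sub_path pd => ? ?; exact: ltW.
have hfv := hoelder_on_sub (lexx a) vb hf; have hxv := hoelder_on_sub (lexx a) vb hx.
have ub := le_trans uv vb.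
have hfu := hoelder_on_sub (lexx a) ub hf; have hxu := hoelder_on_sub (lexx a) ub hx.
have b1 := young_integralP al_gt L0 A0 av hfv hxv pqP.
have b2 := young_integralP al_gt L0 A0 au hfu hxu pP.
have b3 := young_sum_bound al_gt L0 A0 (hoelder_on_sub au vb hf)
   (hoelder_on_sub au vb hx) qP.
have m1 := psum_mesh_cvg al_gt pqP (ltW d0) pqd.
have m2 := psum_mesh_cvg al_gt pP (ltW d0) pd'.
rewrite psum_cat lap in b1.
have {}b1 := le_trans b1 (ler_wpM2l K0 m1).
have {}b2 := le_trans b2 (ler_wpM2l K0 m2).
move: b1 b2 b3; rewrite -/K -/th.
set S1 := psum _ a p; set S2 := psum _ u q => b1 b2 b3.
rewrite [X in `|X|](_ : _ = - (S1 + S2 - young_integral f x a v)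
  + (S1 - young_integral f x a u) + (S2 - young_germ f x u v)); last by ring.
apply: le_trans (ler_normD _ _) _; apply: le_trans (lerD (ler_normD _ _) b3) _.
rewrite lerD2r normrN; apply: le_trans (lerD b1 b2) _.
move: dM; rewrite /M -/th; set D := d `^ _ => /ltW; apply: le_trans.
rewrite [leRHS](_ : _ = K * (D * (v - a)) + K * (D * (u - a)) + D); last ring.
by rewrite lerDl powR_ge0.
Qed.

Lemma young_integral_refl f x L A a b : 0 <= L -> 0 <= A -> a <= b ->
  hoelder_on al L a b f -> hoelder_on al A a b x -> young_integral f x a a = 0.
Proof.
move=> L0 A0 ab hf hx.
have := young_integralP al_gt L0 A0 (lexx a) (hoelder_on_sub (lexx a) ab hf)
   (hoelder_on_sub (lexx a) ab hx) (p := [::]) _.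
move=> /(_ _)/wrap[//|]; rewrite /= sub0r normrN mulr0 normr_le0 => h.
exact/eqP.
Qed.

Lemma hoelder_on_bounded f L a b u : 0 <= L -> hoelder_on al L a b f ->
  a <= u -> u <= b -> `|f u| <= `|f a| + L * (b - a) `^ al.
Proof.
move=> L0 hf au ub; rewrite -{1}(subrK (f a) (f u)) addrC.
apply: le_trans (ler_normD _ _) _; rewrite lerD2l.
apply: le_trans (hf _ _ (lexx a) au ub) _.
by rewrite ler_wpM2l// powR_le// ?(ltW al0)//; lra.
Qed.

(** The integral has the regularity of its integrator, hence can be the integrand of the next level
    of an iterated integral. *)
Lemma young_integral_hoelder f x L A a b : 0 <= L -> 0 <= A ->
  hoelder_on al L a b f -> hoelder_on al A a b x ->
  exists2 L', 0 <= L' & hoelder_on al L' a b (young_integral f x a).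
Proof.
move=> L0 A0 hf hx.
pose L' := young_cst al * (L * A) * (b - a) `^ al + (`|f a| + L * (b - a) `^ al) * A.
have K0 : 0 <= young_cst al * (L * A) by rewrite mulr_ge0 ?young_cst_ge0 ?mulr_ge0//.
exists L'; first by rewrite addr_ge0// mulr_ge0 ?powR_ge0// addr_ge0// mulr_ge0 ?powR_ge0.
move=> u v au uv vb; have := young_increment L0 A0 hf hx au uv vb.
set F := young_integral f x a => h.
rewrite -(subrK (young_germ f x u v) (F v - F u)).
apply: le_trans (ler_normD _ _) _; rewrite /L' mulrDl lerD//.
  apply: le_trans h _; rewrite /th powRD_gt0// mulrA ler_wpM2r ?powR_ge0//.
  by rewrite ler_wpM2l// powR_le// ?(ltW al0)//; lra.
rewrite /young_germ normrM -[leRHS]mulrA ler_pM//.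
  by apply: hoelder_on_bounded => //; exact: le_trans vb.
exact: hx.
Qed.

End young_indefinite.

Section grid_sums.
Variables (R : realType) (al : R).
Hypothesis al_gt : 2^-1 < al.
Hypothesis al_lt : al < 1.
Variables (a b : R).
Hypothesis ab : a < b.

Let th := al + al.
Let th1 : 1 < th. Proof. by move: al_gt; rewrite /th => h; lra. Qed.
Let al0 : 0 < al. Proof. by apply: lt_trans al_gt; rewrite invr_gt0. Qed.

Definition grid_point (n : nat) (j : nat) : R := a + j%:R * ((b - a) / 2 ^+ n).

(** The discrete counterpart of [young_integral]: [S l] stands for the integrand at the grid point
    of index [l]. *)
Definition grid_step (n : nat) (x : R -> R) (S : nat -> R) (j : nat) : R :=
  \sum_(l < j) S l * (x (grid_point n l.+1) - x (grid_point n l)).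

Let h n : R := (b - a) / 2 ^+ n.
Let h_gt0 n : 0 < h n. Proof. by rewrite divr_gt0 ?subr_gt0// exprn_gt0. Qed.

Lemma grid_point_diff n i j :
  grid_point n j - grid_point n i = (j%:R - i%:R) * ((b - a) / 2 ^+ n).
Proof. by rewrite /grid_point; ring. Qed.

Lemma grid_point_lt n i j : (grid_point n i < grid_point n j) = (i < j)%N.
Proof. by rewrite -subr_gt0 grid_point_diff pmulr_lgt0 ?h_gt0// subr_gt0 ltr_nat. Qed.

Lemma grid_point_le n i j : (grid_point n i <= grid_point n j) = (i <= j)%N.
Proof. by rewrite leNgt grid_point_lt -leqNgt. Qed.

Lemma grid_point0 n : grid_point n 0 = a.
Proof. by rewrite /grid_point mul0r addr0. Qed.

Lemma grid_point_last n : grid_point n (2 ^ n) = b.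
Proof.
rewrite /grid_point natrX mulrC divfK ?expf_neq0//; ring.
Qed.

Lemma grid_point_itv n j : (j <= 2 ^ n)%N -> a <= grid_point n j <= b.
Proof.
by move=> jn; rewrite -{1}(grid_point0 n) -(grid_point_last n) !grid_point_le jn.
Qed.

Lemma grid_step_diff n x S i k :
  grid_step n x S (i + k) - grid_step n x S i =
  psum (fun l m => S l * (x (grid_point n m) - x (grid_point n l))) i (iota i.+1 k).
Proof.
elim: k i => [|k IH] i /=; first by rewrite addn0 subrr.
rewrite -IH.
have -> : grid_step n x S i.+1 = grid_step n x S i +
    S i * (x (grid_point n i.+1) - x (grid_point n i)).
  by rewrite /grid_step big_ord_recr.
rewrite addnS -addSn; ring.
Qed.

(** The error [S - F] is controlled in the Hoelder seminorm of exponent [al] along the grid, at rate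
    [h n ^ (th - 1)]: a uniform bound would not be inherited by Young sums against [x]. It vanishes
    at index 0, so the seminorm also bounds its values. *)
Definition grid_close (S : nat -> nat -> R) (F : R -> R) :=
  exists2 C, 0 <= C & forall n, S n 0%N = F a /\
   forall i j, (i <= j)%N -> (j <= 2 ^ n)%N ->
    `|(S n j - F (grid_point n j)) - (S n i - F (grid_point n i))| <=
      C * (h n) `^ (th - 1) * (grid_point n j - grid_point n i) `^ al.

(** The new error splits in two: the discrete Young sum of the old error against [x], to which the
    sewing bound applies with indices as points, and the accumulated local errors of the germs of
    [F]. *)
Lemma grid_close_step (x : R -> R) A S F L : 0 <= A -> 0 <= L ->
  hoelder_on al A a b x -> hoelder_on al L a b F -> grid_close S F ->
  grid_close (fun n => grid_step n x (S n)) (young_integral F x a).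
Proof.
move=> A0 L0 hx hF [C C0 HC].
set G := young_integral F x a; pose K := young_cst al * (L * A).
have K0 : 0 <= K by rewrite mulr_ge0 ?young_cst_ge0 ?mulr_ge0//.
have sc0 : 0 <= sewing_cst th by exact: sewing_cst_ge0.
have G0 : G a = 0 by exact: (young_integral_refl al_gt L0 A0 (ltW ab) hF hx).
pose ba := (b - a) `^ al.
(* The three terms come from the bounds [B2], [B1] and [B3] below, in this order. *)
pose C' := C * ba * A + sewing_cst th * (C * A) * ba + K * (b - a) `^ (1 - al).
exists C'.
  rewrite addr_ge0 ?addr_ge0// !mulr_ge0 ?powR_ge0//.
move=> n; split; first by rewrite /grid_step big_ord0 G0.
move=> i j /subnKC <-; move: (j - i)%N => k ikn {j}.
have {HC} [HS0 HS] := HC n.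
pose tau := grid_point n; pose X l := x (tau l).
pose e l := S n l - F (tau l).
have e0 : e 0%N = 0 by rewrite /e HS0 /tau grid_point0 subrr.
have -> : forall s1 s2 : R, s1 - G (tau (i + k)%N) - (s2 - G (tau i)) =
    (s1 - s2) - (G (tau (i + k)%N) - G (tau i)) by move=> *; ring.
rewrite grid_step_diff -/tau.
set p := iota i.+1 k.
have lp : last i p = (i + k)%N.
  by rewrite /p; elim: (k) (i) => [|k' IH] i' /=; rewrite ?addn0// IH addSnnS.
have pP : path (fun l m => m == l.+1) i p.
  by rewrite /p; elim: (k) (i) => [//|k' IH] i' /=; rewrite eqxx IH.
have pn : all (fun l => (l <= 2 ^ n)%N) (i :: p).
  apply/allP => z zp; apply: leq_trans ikn.
  by move: zp; rewrite -[i :: p]/(iota i k.+1) mem_iota addnS ltnS => /andP[].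
pose Xe l m := e l * (X m - X l).
pose Xg l m := young_germ F x (tau l) (tau m).
pose dG l m := G (tau m) - G (tau l).
have -> : psum (fun l m => S n l * (x (tau m) - x (tau l))) i p
    - (G (tau (i + k)%N) - G (tau i)) = psum Xe i p + psum (fun l m => Xg l m - dG l m) i p.
  rewrite -lp -(psum_telescope (G \o tau)) (psumB Xg dG) addrA; congr (_ - _).
  by rewrite -[LHS](subrK (psum Xg i p)) -psumB; congr (psum _ _ _ + _);
    apply/funext => l; apply/funext => m; rewrite /Xe /Xg /e /X /young_germ; ring.
set hh := h n `^ (th - 1); have hh0 : 0 <= hh by exact: powR_ge0.
set dl := tau (i + k)%N - tau i.
have dl0 : 0 <= dl by rewrite subr_ge0 grid_point_le leq_addr.
have ti := grid_point_itv (leq_trans (leq_addr k i) ikn).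
have tik := grid_point_itv ikn.
have dlba : dl <= b - a by move: ti tik; rewrite /dl /tau => /andP[? ?] /andP[? ?]; lra.
have bX l m : (l <= m)%N -> (m <= 2 ^ n)%N -> `|X m - X l| <= A * (tau m - tau l) `^ al.
  move=> lm mn; have /andP[? _] := grid_point_itv (leq_trans lm mn).
  have /andP[_ ?] := grid_point_itv mn.
  by apply: hx => //; rewrite grid_point_le.
have B1 : `|psum Xe i p - Xe i (i + k)%N| <=
    sewing_cst th * (C * hh * A) * dl `^ th.
  rewrite -lp /dl -lp.
  apply: (sewing_bound (tau := tau) (D := fun l => (l <= 2 ^ n)%N)) => //.
  - by rewrite !mulr_ge0.
  - by move=> l; rewrite /Xe subrr mulr0.
  - move=> u v w un vn wn /andP[]; rewrite !grid_point_le => uv vw.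
    rewrite [X in `|X|](_ : _ = - ((e v - e u) * (X w - X v))); last by rewrite /Xe; ring.
    have uv' : grid_point n u <= grid_point n v by rewrite grid_point_le.
    have vw' : grid_point n v <= grid_point n w by rewrite grid_point_le.
    rewrite normrN normrM /th powRD_gt0// mulrACA /tau ler_pM//.
      apply: le_trans (HS _ _ uv vn) _; rewrite -/hh ler_wpM2l ?mulr_ge0//.
      by rewrite powR_le ?(ltW al0)//; lra.
    apply: le_trans (bX _ _ vw wn) _; rewrite ler_wpM2l//.
    by rewrite /tau powR_le ?(ltW al0)//; lra.
  - by apply: sub_path pP => l m /eqP ->; rewrite grid_point_lt.
have B2 : `|Xe i (i + k)%N| <= C * hh * ba * (A * dl `^ al).
  rewrite normrM ler_pM//; last by apply: bX => //; exact: leq_addr.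
  rewrite -[e i]subr0 -{1}e0; apply: le_trans (HS _ _ _ _) _ => //.
    exact: leq_trans (leq_addr k i) ikn.
  rewrite -/hh ler_wpM2l ?mulr_ge0// grid_point0 powR_le ?(ltW al0)// /tau.
    by rewrite subr_ge0; case/andP: ti.
  by case/andP: ti => _ ?; rewrite lerD2r.
(* Each of the [k] germs is off by at most [K * h n ^ th], and [k] steps of length [h n] add up to
   [dl]. *)
have B3 : `|psum (fun l m => Xg l m - dG l m) i p| <= K * hh * dl.
  have : `|psum (fun l m => Xg l m - dG l m) i p| <=
      psum (fun l m => K * (h n `^ th)) i p.
    apply: (psum_norm_le (D := fun l => (l <= 2 ^ n)%N) (ltT := fun l m => m == l.+1)) => //.
    move=> l m ln mn /eqP ml; rewrite distrC.
    have /andP[? _] := grid_point_itv ln; have /andP[_ ?] := grid_point_itv mn.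
    have lm : grid_point n l <= grid_point n m by rewrite grid_point_le ml.
    apply: le_trans (young_increment al_gt L0 A0 hF hx _ lm _) _ => //.
    by rewrite -/K grid_point_diff ml -natr1 addrAC subrr add0r mul1r.
  move=> /le_trans; apply; rewrite psumZ -mulrA ler_wpM2l//.
  have -> : psum (fun _ _ => h n `^ th) i p = k%:R * h n `^ th.
    rewrite /p; elim: (k) (i) => [|k' IH] i' /=; first by rewrite mul0r.
    by rewrite IH -natr1 mulrDl mul1r addrC.
  rewrite /dl grid_point_diff natrD addrAC subrr add0r -/(h n) mulrCA ler_wpM2l//.
  rewrite /hh; have := @powR_le_split R (h n) (h n) 1 th ltr01 (ltW th1) (ltW (h_gt0 n)) (lexx _).
  by rewrite powRr1// ltW.
have dlth : dl `^ th <= ba * dl `^ al.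
  by rewrite /th powRD_gt0// ler_wpM2r ?powR_ge0// powR_le// ltW.
have dl1 : dl <= (b - a) `^ (1 - al) * dl `^ al.
  by have := powR_le_split al0 (ltW al_lt) dl0 dlba; rewrite powRr1.
rewrite -(subrK (Xe i (i + k)%N) (psum Xe i p)).
apply: le_trans (ler_normD _ _) _.
apply: le_trans (lerD (ler_normD _ _) B3) _.
apply: le_trans (lerD (lerD B1 B2) (lexx _)) _.
rewrite [leRHS](_ : _ = sewing_cst th * (C * hh * A) * (ba * dl `^ al)
   + C * hh * ba * (A * dl `^ al) + K * hh * ((b - a) `^ (1 - al) * dl `^ al)); last first.
  by rewrite /C' -/hh -/dl; ring.
by rewrite !lerD// ler_wpM2l// !mulr_ge0.
Qed.

Definition grid_iterated d (x : 'I_d -> R -> R) (I : seq 'I_d) (n : nat) : nat -> R :=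
  foldl (fun S i => grid_step n (x i) S) (fun=> 1) I.

Lemma grid_close_iterated d (x : 'I_d -> R -> R) A (I : seq 'I_d) : 0 <= A ->
  (forall i, hoelder_on al A a b (x i)) ->
  (fun n => grid_iterated x I n (2 ^ n)) @ \oo --> iterated_integral x a b I.
Proof.
move=> A0 hx.
(* The first letter acts first, so both folds are generalized over their accumulators. *)
have gen F S : (exists2 L, 0 <= L & hoelder_on al L a b F) -> grid_close S F ->
    grid_close (fun n => foldl (fun S i => grid_step n (x i) S) (S n) I)
      (foldl (fun (F : R -> R) i => fun r : R => young_integral F (x i) a r) F I).
  elim: I F S => [//|i I IH] F S [L L0 hF] cl /=.
  apply: (IH _ (fun n => grid_step n (x i) (S n))).
    exact: (young_integral_hoelder al_gt L0 A0).
  exact: (grid_close_step A0 L0 (hx i) hF).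
have h1 : exists2 L, 0 <= L & hoelder_on al L a b (fun=> 1).
  by exists 0 => // u v _ _ _; rewrite subrr normr0 mul0r.
have h2 : grid_close (fun _ _ => 1) (fun=> 1).
  by exists 0 => // n; split=> // i j _ _; rewrite !subrr normr0 !mul0r.
have [C C0 HC] := gen _ _ h1 h2.
rewrite /iterated_integral; set F := foldl _ _ I in HC *.
apply/cvgrPdist_le => e e0.
have : (fun n => C * (b - a) `^ al * (h n) `^ (th - 1)) @ \oo --> (0 : R).
  rewrite -[X in _ --> X](mulr0 (C * (b - a) `^ al)); apply: cvgMl_tmp.
  by apply: cvg_powR_half; rewrite ?subr_ge0 ?subr_gt0// ltW.
move=> /cvgrPdist_le/(_ _ e0); apply: filterS => n.
rewrite sub0r normrN ger0_norm; last by rewrite !mulr_ge0 ?powR_ge0.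
apply: le_trans; have [S0 /(_ 0%N _ isT (leqnn _))] := HC n.
rewrite S0 grid_point0 grid_point_last subrr subr0 distrC => /le_trans; apply.
by rewrite mulrAC.
Qed.

End grid_sums.

(** * Hoelder continuity from dyadic increments *)

Section dyadic_chaining.
Variables (R : realType) (al a b : R).
Hypothesis al0 : 0 < al.
Hypothesis ab : a < b.
Variables (f : R -> R) (C : R).
Hypothesis C0 : 0 <= C.
Hypothesis f_dyadic : forall n j, (j < 2 ^ n)%N ->
  `|f (grid_point a b n j.+1) - f (grid_point a b n j)| <=
    C * ((b - a) / 2 ^+ n) `^ al.
Hypothesis f_cont : forall (u : nat -> R) x, a <= x <= b ->
  (forall n, a <= u n <= b) -> u @ \oo --> x -> f \o u @ \oo --> f x.

Let h n : R := (b - a) / 2 ^+ n.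
Let h_gt0 n : 0 < h n. Proof. by rewrite divr_gt0 ?subr_gt0// exprn_gt0. Qed.
Let hS n : h n = 2 * h n.+1.
Proof. by rewrite /h exprS invfM mulrCA (mulrA 2) divff// mul1r. Qed.

(** [pr n x] is the last grid point of level [n] not exceeding [x]; chaining follows these points as
    [n] grows. *)
Let ix n x := Num.truncn ((x - a) / h n).
Let pr n x := grid_point a b n (ix n x).

Let ixP n x : a <= x -> (ix n x)%:R * h n <= x - a < (ix n x)%:R * h n + h n.
Proof.
move=> ax; have := @Num.Theory.truncn_itv R ((x - a) / h n).
rewrite divr_ge0 ?subr_ge0//; last exact: ltW.
move=> /(_ isT)/andP[]; rewrite -/(ix n x) ler_pdivlMr// ltr_pdivrMr// => -> /=.
by rewrite -natr1 mulrDl mul1r.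
Qed.

Let ix_eq n x j : a <= x -> j%:R * h n <= x - a < j%:R * h n + h n -> ix n x = j.
Proof.
move=> ax jx; apply/eqP; rewrite eqn_leq.
have /andP[i1 i2] := ixP n ax; case/andP: jx => j1 j2.
have k1 : (ix n x)%:R * h n < j.+1%:R * h n by rewrite -natr1 mulrDl mul1r; lra.
have k2 : j%:R * h n < (ix n x).+1%:R * h n by rewrite -natr1 mulrDl mul1r; lra.
by move: k1 k2; rewrite !ltr_pM2r// !ltr_nat !ltnS => -> ->.
Qed.

Let ix_le n x : a <= x <= b -> (ix n x <= 2 ^ n)%N.
Proof.
move=> /andP[ax xb]; have /andP[i1 _] := ixP n ax.
rewrite -(ler_nat R) -(ler_pM2r (h_gt0 n)); apply: le_trans i1 _.
by rewrite natrX mulrC divfK ?expf_neq0//; lra.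
Qed.

Let pr_itv n x : a <= x <= b -> a <= pr n x <= b.
Proof. by move=> axb; apply: grid_point_itv => //; exact: ix_le. Qed.

Let pr_cvg x : a <= x <= b -> (pr n x) @[n --> \oo] --> x.
Proof.
move=> /andP[ax xb]; apply/cvgrPdist_le => e e0.
have := @cvg_powR_half R (b - a) 1 _ ltr01; rewrite subr_ge0 (ltW ab) => /(_ isT).
move=> /cvgrPdist_le/(_ _ e0); apply: filterS => n.
rewrite sub0r normrN powRr1 -/(h n) ?(ltW (h_gt0 n))// ger0_norm ?(ltW (h_gt0 n))//.
apply: le_trans; have /andP[i1 i2] := ixP n ax; rewrite /pr /grid_point -/(h n).
by rewrite ler_norml; apply/andP; split; move: (h_gt0 n) => ?; lra.
Qed.

(** At the next level the point either stays or moves right by one interval of that level, so a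
    single dyadic increment is involved. *)
Let pr_step n x : a <= x <= b -> `|f (pr n.+1 x) - f (pr n x)| <= C * h n `^ al.
Proof.
move=> axb; have /andP[ax xb] := axb.
have /andP[i1 i2] := ixP n ax; have /andP[j1 j2] := ixP n.+1 ax.
have E2 : grid_point a b n.+1 (ix n x).*2 = pr n x.
  by rewrite /pr /grid_point -/(h n) -/(h n.+1) (hS n) -muln2 natrM; ring.
have E3 : (ix n x).*2%:R = 2 * (ix n x)%:R :> R by rewrite -mul2n natrM.
have E4 : (ix n x).*2.+1%:R = 2 * (ix n x)%:R + 1 :> R by rewrite -addn1 natrD E3.
have : ix n.+1 x = (ix n x).*2 \/ ix n.+1 x = (ix n x).*2.+1.
  have [lt|ge] := ltP (x - a) ((ix n x).*2.+1%:R * h n.+1); [left|right].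
    apply: ix_eq => //; move: lt i1; rewrite (hS n) E3 E4 => *.
    by apply/andP; split; lra.
  apply: ix_eq => //; rewrite ge /=; move: i2; rewrite (hS n) E4 => ?; lra.
have c0 : 0 <= C * h n `^ al by rewrite mulr_ge0// powR_ge0.
case=> e; rewrite {1}/pr e ?E2 ?subrr ?normr0// -E2.
apply: le_trans (f_dyadic _) _; first by rewrite -[X in (X <= _)%N]e; exact: ix_le.
rewrite -/(h n.+1) ler_wpM2l// powR_le// ?(ltW al0) ?(ltW (h_gt0 _))//.
by rewrite (hS n); move: (h_gt0 n.+1) => ?; lra.
Qed.

Let rho : R := 2^-1 `^ al.
Let rho_lt1 : rho < 1.
Proof.
have : (2^-1 : R) `^ al < 1 `^ al.
  by apply: gt0_ltr_powR; rewrite ?nnegrE// invf_lt1// ltr1n.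
by rewrite powR1.
Qed.
(** The sum of the geometric series of ratio [rho] formed by the bounds on the successive steps of a
    chain. *)
Let c := C / (1 - rho).
Let cE : c * rho + C = c.
Proof.
have : 1 - rho != 0 by rewrite subr_eq0 gt_eqF.
by rewrite /c; move: rho => r r0; field.
Qed.
Let c_ge0 : 0 <= c. Proof. by rewrite divr_ge0// subr_ge0 ltW. Qed.
Let h_powS n : h n.+1 `^ al = rho * h n `^ al.
Proof.
rewrite -powRM ?invr_ge0// ?(ltW (h_gt0 n))//; congr (_ `^ _).
by rewrite (hS n) mulrA mulVf// mul1r.
Qed.

Let pr_chain m n x : a <= x <= b -> `|f (pr (n + m) x) - f (pr n x)| <= c * h n `^ al.
Proof.
move=> axb; elim: m n => [|m IH] n.
  by rewrite addn0 subrr normr0 mulr_ge0// powR_ge0.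
rewrite addnS -addSn -(subrKA (f (pr n.+1 x))).
apply: le_trans (ler_normD _ _) _; apply: le_trans (lerD (IH _) (pr_step _ axb)) _.
by rewrite h_powS mulrA -mulrDl cE.
Qed.

Let pr_lim n x : a <= x <= b -> `|f x - f (pr n x)| <= c * h n `^ al.
Proof.
move=> axb.
have c1 : (fun m => `|f (pr (m + n) x) - f (pr n x)|) @ \oo --> `|f x - f (pr n x)|.
  apply: cvg_norm; apply: cvgB; last exact: cvg_cst.
  apply: (f_cont (u := fun m => pr (m + n) x)) => //; first by move=> m; exact: pr_itv.
  by rewrite (cvg_shiftn n (pr^~ x)); exact: pr_cvg.
have c2 : (fun m : nat => c * h n `^ al) @ \oo --> c * h n `^ al by exact: cvg_cst.
by apply: (ler_cvg_to c1 c2); apply: nearW => m; rewrite addnC; exact: pr_chain.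
Qed.

(** Kolmogorov's chaining. At the level [n] with [h n.+1 < v - u <= h n] the projections of [u] and
    [v] are equal or adjacent, which gives the terms [c], [C] and [c]; the factor [2 ^ al] comes
    from [h n = 2 * h n.+1]. *)
Lemma dyadic_hoelder : exists2 L, 0 <= L & hoelder_on al L a b f.
Proof.
exists ((c + C + c) * 2 `^ al); first by rewrite mulr_ge0 ?powR_ge0// !addr_ge0.
move=> u v au uv vb; have [<-|nuv] := eqVneq u v.
  by rewrite subrr normr0 !mulr_ge0 ?powR_ge0// !addr_ge0.
have {nuv}uv' : 0 < v - u by rewrite subr_gt0 lt_neqAle nuv.
have exn : exists n, h n < v - u.
  have := @cvg_powR_half R (b - a) 1 _ ltr01; rewrite subr_ge0 (ltW ab) => /(_ isT).
  move=> /cvgrPdist_lt/(_ _ uv')[n _ /(_ n (leqnn n))].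
  rewrite sub0r normrN powRr1 -/(h n) ?(ltW (h_gt0 n))// ger0_norm ?(ltW (h_gt0 n))//.
  by exists n.
(* Level 0 is impossible: [h 0] is [b - a], which is at least [v - u]. *)
case: (ex_minnP exn) => [[|n]].
  by rewrite /h expr0 divr1 => hlt; exfalso; move: hlt; lra.
move=> hn minn; have hn' : v - u <= h n.
  by rewrite leNgt; apply/negP => /minn; rewrite ltnn.
have auv : a <= u <= b by rewrite au (le_trans uv).
have avb : a <= v <= b by rewrite vb (le_trans au).
have /andP[i1 i2] := ixP n au; have /andP[j1 j2] := ixP n (le_trans au uv).
have hp := h_gt0 n.
have mid : `|f (pr n v) - f (pr n u)| <= C * h n `^ al.
  have : (ix n u <= ix n v <= (ix n u).+1)%N.
    have k1 : (ix n u)%:R * h n < (ix n v).+1%:R * h n by rewrite -natr1 mulrDl mul1r; lra.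
    have k2 : (ix n v)%:R * h n < (ix n u).+2%:R * h n.
      by rewrite -natr1 -natr1 !mulrDl mul1r; lra.
    by move: k1 k2; rewrite !ltr_pM2r// !ltr_nat !ltnS => -> ->.
  rewrite (leq_eqVlt (ix n v)) ltnS => /andP[le1 /predU1P[e|le2]].
    rewrite /pr e; apply: f_dyadic; rewrite -e; exact: ix_le.
  have -> : pr n v = pr n u by congr grid_point; apply/eqP; rewrite eqn_leq le1 le2.
  by rewrite subrr normr0 mulr_ge0// powR_ge0.
have -> : f v - f u = (f v - f (pr n v)) + (f (pr n v) - f (pr n u)) - (f u - f (pr n u)).
  by ring.
apply: le_trans (ler_normB _ _) _.
apply: le_trans (lerD (ler_normD _ _) (pr_lim n auv)) _.
apply: le_trans (lerD (lerD (pr_lim n avb) mid) (lexx _)) _.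
rewrite -!mulrDl -mulrA ler_wpM2l ?addr_ge0// -powRM ?(ltW uv')//.
by rewrite powR_le ?(ltW al0) ?(ltW hp)//; rewrite (hS n); lra.
Qed.

End dyadic_chaining.

(** * Gaussian moment generating functions *)

Section weighted_transfer.
Local Open Scope ereal_scope.
Context (R : realType) d1 d2 d (T1 : measurableType d1) (T2 : measurableType d2)
  (Z : measurableType d).
Variables (mu1 : {measure set T1 -> \bar R}) (mu2 : {measure set T2 -> \bar R}).
Variables (phi1 : T1 -> Z) (phi2 : T2 -> Z) (w1 : T1 -> R) (w2 : T2 -> R).
Hypotheses (mphi1 : measurable_fun setT phi1) (mphi2 : measurable_fun setT phi2).
Hypotheses (mw1 : measurable_fun setT w1) (mw2 : measurable_fun setT w2).
Hypotheses (w1_ge0 : forall x, (0 <= w1 x)%R) (w2_ge0 : forall x, (0 <= w2 x)%R).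
Import HBNNSimple.

(** Serves two purposes: passing from a random variable to its law, with a density as second weight,
    and replacing a random factor by a constant in the independence argument. The extension from
    sets to functions goes through simple functions and monotone convergence. *)
Lemma weighted_transfer :
  (forall A, measurable A ->
    \int[mu1]_x (\1_A (phi1 x) * w1 x)%:E = \int[mu2]_x (\1_A (phi2 x) * w2 x)%:E) ->
  forall f : Z -> R, measurable_fun setT f -> (forall z, (0 <= f z)%R) ->
    \int[mu1]_x (f (phi1 x) * w1 x)%:E = \int[mu2]_x (f (phi2 x) * w2 x)%:E.
Proof.
move=> H f mf f0.
have mEf : measurable_fun setT (EFin \o f) by exact/measurable_EFinP.
have step (h : {nnsfun Z >-> R}) :
    \int[mu1]_x (h (phi1 x) * w1 x)%:E = \int[mu2]_x (h (phi2 x) * w2 x)%:E.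
  have gen d' (T : measurableType d') (mu : {measure set T -> \bar R}) (phi : T -> Z)
      (w : T -> R) : measurable_fun setT phi -> measurable_fun setT w ->
      (forall x, (0 <= w x)%R) ->
      \int[mu]_x (h (phi x) * w x)%:E =
      \sum_(y \in range h) y%:E * \int[mu]_x (\1_(h @^-1` [set y]) (phi x) * w x)%:E.
    move=> mphi mw w0.
    transitivity (\int[mu]_x (\sum_(y \in range h)
        (y * (\1_(h @^-1` [set y]) (phi x) * w x))%:E)).
      apply: eq_integral => x _; rewrite fsumEFin//; congr EFin.
      rewrite {1}(fimfunE h) mulr_fsuml; apply: eq_fsbigr => y _.
      by rewrite mulrA.
    rewrite ge0_integral_fsum//.
    - apply: eq_fsbigr => y; rewrite inE => -[z _ <-].
      rewrite -ge0_integralZl//.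
      + by apply/measurable_EFinP/measurable_funM => //; apply: measurableT_comp.
      + by move=> x _; rewrite lee_fin mulr_ge0.
      + by rewrite lee_fin.
    - move=> y; apply/measurable_EFinP/measurable_funM => //.
      by apply: measurable_funM => //; apply: measurableT_comp.
    - move=> y x _; rewrite lee_fin.
      have [[z _ <-]|ny] := pselect (range h y); first by rewrite !mulr_ge0.
      rewrite (_ : \1_ _ _ = 0%R) ?mul0r ?mulr0//.
      by rewrite indicE memNset// => hy; apply: ny; exists (phi x).
  rewrite gen// gen//; apply: eq_fsbigr => y _; congr (_ * _).
  exact: H.
pose g := nnsfun_approx measurableT mEf.
have gen d' (T : measurableType d') (mu : {measure set T -> \bar R}) (phi : T -> Z)
      (w : T -> R) : measurable_fun setT phi -> measurable_fun setT w ->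
      (forall x, (0 <= w x)%R) ->
    \int[mu]_x (f (phi x) * w x)%:E = limn (fun n => \int[mu]_x (g n (phi x) * w x)%:E).
  move=> mphi mw w0; rewrite -monotone_convergence//.
  - apply: eq_integral => x _; apply/esym/cvg_lim => //.
    under eq_fun do rewrite EFinM.
    rewrite EFinM; apply: cvgeZr => //.
    by apply: (@cvg_nnsfun_approx _ _ _ _ measurableT _ mEf) => // z _; rewrite lee_fin.
  - move=> n; apply/measurable_EFinP/measurable_funM => //.
    by apply: measurableT_comp.
  - by move=> n x _; rewrite lee_fin mulr_ge0.
  - move=> x _ m n mn; rewrite lee_fin ler_wpM2r//.
    exact/lefP/nd_nnsfun_approx.
rewrite gen// gen//; congr (limn _); apply/funext => n; exact: step.
Qed.

End weighted_transfer.

Section gaussian_mgf.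
Context (R : realType) d (Om : measurableType d) (P : probability Om R).
Local Open Scope ereal_scope.

(** Completing the square; the moment generating function then needs only the total mass of a
    Gaussian density. *)
Lemma normal_pdf_tilt (m s th x : R) : s != 0%R ->
  (expR (th * x) * normal_pdf m s x =
   expR (th * m + th ^+ 2 * (s ^+ 2 / 2)) * normal_pdf (m + th * s ^+ 2) s x)%R.
Proof.
move=> s0; rewrite !normal_pdfE// /normal_fun mulrCA [RHS]mulrCA; congr (_ * _)%R.
rewrite -!expRD; congr expR; have q0 : (s ^+ 2 != 0)%R by rewrite sqrf_eq0.
move: (s ^+ 2)%R q0 => q q0; rewrite -!(mulr_natr q 2).
by apply/eqP; rewrite -subr_eq0; apply/eqP; field.
Qed.

(** The Dirac case fits the same formula with [v = 0]. Later arguments use this formula instead of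
    the law. *)
Lemma gaussian_mgf (X : Om -> R) : measurable_fun setT X -> gaussian P X ->
  exists m v : R, (0 <= v)%R /\ forall th : R,
    \int[P]_w (expR (th * X w))%:E = (expR (th * m + th ^+ 2 * (v / 2)))%:E.
Proof.
move=> mX [m [s HX]]; exists m, (s ^+ 2)%R; split; first exact: sqr_ge0.
have mexp th : measurable_fun setT (fun x : R => expR (th * x)).
  by apply: measurableT_comp => //; exact: measurable_funM.
have pre A : measurable A -> \int[P]_w (\1_A (X w) * 1)%:E = P (X @^-1` A).
  move=> mA; under eq_integral do rewrite mulr1.
  rewrite [LHS](_ : _ = \int[P]_w (\1_(X @^-1` A) w)%:E)//.
  by rewrite integral_indic// ?setIT// -[_ @^-1` _]setTI; exact: mX.
move=> th; rewrite [LHS](_ : _ = \int[P]_w (expR (th * X w) * 1)%:E); last first.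
  by apply: eq_integral => w _; rewrite mulr1.
have [s0|s0] := eqVneq s 0%R.
  transitivity (\int[\d_m]_x (expR (th * x) * 1)%:E).
    apply: (@weighted_transfer R _ _ _ _ _ _ P (\d_m : {measure set R -> \bar R})
      X idfun (cst 1%R) (cst 1%R) mX _ _ _ _ _ _ (fun x => expR (th * x))%R) => //.
      exact: measurable_id.
    move=> A mA; rewrite pre// HX// /gaussian_law s0 eqxx.
    under eq_integral do rewrite mulr1.
    by rewrite integral_indic// setIT.
  rewrite integral_dirac//; last first.
    by apply/measurable_EFinP; apply: measurable_funM => //; exact: mexp.
  by rewrite diracT mul1e mulr1 s0 expr0n/= mul0r mulr0 addr0.
transitivity (\int[lebesgue_measure]_x (expR (th * x) * normal_pdf m s x)%:E).
  apply: (@weighted_transfer R _ _ _ _ _ _ P (@lebesgue_measure R)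
     X idfun (cst 1%R) (normal_pdf m s) mX _ _ _ _ _ _ (fun x => expR (th * x))%R) => //.
  - exact: measurable_id.
  - exact: measurable_normal_pdf.
  - by move=> x; exact: normal_pdf_ge0.
  - move=> A mA; rewrite pre// HX// /gaussian_law (negbTE s0) /normal_prob.
    rewrite [LHS]integral_mkcond;apply: eq_integral => x _.
    by rewrite patchE /= indicE; case: ifPn => xA; rewrite ?mul1r ?mul0r.
under eq_integral do rewrite normal_pdf_tilt// EFinM.
rewrite ge0_integralZl//.
- by rewrite integral_normal_pdf mule1.
- by apply/measurable_EFinP; exact: measurable_normal_pdf.
- by move=> x _; rewrite lee_fin normal_pdf_ge0.
Qed.

End gaussian_mgf.

(** * Random variables with moments of all orders *)

(** Since (N + n)! is at least N!, the tail of the series is dominated term by term by [|x| ^+ n]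
    times the series at [|x|]. *)
Lemma expR_taylor (R : realType) (n : nat) (x : R) :
  `|expR x - \sum_(j < n) x ^+ j / j`!%:R| <= `|x| ^+ n * expR `|x|.
Proof.
have cv y : series (exp_coeff y) @ \oo --> expR y.
  exact: is_cvg_series_exp_coeff.
have c1 : (fun N => `|series (exp_coeff x) (N + n)%N - \sum_(j < n) x ^+ j / j`!%:R|) @ \oo
    --> `|expR x - \sum_(j < n) x ^+ j / j`!%:R|.
  apply: cvg_norm; apply: cvgB; last exact: cvg_cst.
  by rewrite (cvg_shiftn n (series (exp_coeff x))); exact: cv.
have c2 : (fun N => `|x| ^+ n * series (exp_coeff `|x|) N) @ \oo --> `|x| ^+ n * expR `|x|.
  by apply: cvgMl_tmp; exact: cv.
apply: (ler_cvg_to c1 c2); apply: nearW => N.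
rewrite /series /= addnC big_mkord big_split_ord /= addrC addrK big_mkord mulr_sumr.
apply: le_trans (ler_norm_sum _ _ _) _; apply: ler_sum => i _.
rewrite /exp_coeff /= normrM normrX exprD -mulrA normfV normr_nat.
rewrite ler_wpM2l ?exprn_ge0// ler_wpM2l ?exprn_ge0//.
rewrite lef_pV2 ?posrE ?ltr0n ?fact_gt0// ler_nat.
by elim: n {c1 c2} => [//|n IH]; rewrite addSn factS (leq_trans IH)// leq_pmull.
Qed.

(** Used to read moments off a moment generating function. Small [th] forces the constant
    coefficient to vanish; dividing by [th] then reduces [n] by one. *)
Lemma coef_eq0_near0 (R : realType) (n : nat) (a : nat -> R) (c : R) :
  (forall th, 0 < th <= 1 -> `|\sum_(i < n) a i * th ^+ i| <= c * th ^+ n) ->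
  forall i, (i < n)%N -> a i = 0.
Proof.
elim: n a => [//|n IH] a H.
have E th : \sum_(i < n.+1) a i * th ^+ i = a 0%N + th * \sum_(i < n) a i.+1 * th ^+ i.
  rewrite big_ord_recl expr0 mulr1; congr (_ + _); rewrite mulr_sumr.
  by apply: eq_bigr => i _; rewrite lift0 exprS mulrCA.
have a0 : a 0%N = 0.
  apply/eqP; rewrite -normr_le0; apply/ler_addgt0Pl => e e0; rewrite addr0.
  pose M := `|c| + \sum_(i < n) `|a i.+1| + 1.
  have M0 : 0 < M by rewrite ltr_pwDr// addr_ge0// sumr_ge0.
  pose th := Num.min 1 (e / M).
  have th0 : 0 < th by rewrite lt_min ltr01 divr_gt0.
  have th1 : th <= 1 by rewrite ge_min lexx.
  have thX k : th ^+ k <= 1 by rewrite exprn_ile1// ltW.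
  have := H th; rewrite th0 th1 => /(_ isT); rewrite E => h.
  have -> : a 0%N = (a 0%N + th * \sum_(i < n) a i.+1 * th ^+ i)
     - th * \sum_(i < n) a i.+1 * th ^+ i by rewrite addrK.
  apply: le_trans (ler_normB _ _) _.
  apply: (@le_trans _ _ (th * M)); last first.
    by rewrite mulrC -ler_pdivlMl// mulrC ge_min lexx orbT.
  rewrite /M mulrDr mulrDr mulr1 -[leLHS]addr0; apply: lerD; last exact: ltW.
  apply: lerD.
    apply: le_trans h _; rewrite exprS mulrCA ler_wpM2l ?(ltW th0)//.
    apply: (@le_trans _ _ (`|c| * th ^+ n)).
      by rewrite ler_wpM2r ?exprn_ge0 ?(ltW th0)// ler_norm.
    by rewrite ler_piMr.
  rewrite normrM gtr0_norm// ler_wpM2l ?(ltW th0)//.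
  apply: le_trans (ler_norm_sum _ _ _) _; apply: ler_sum => i _.
  by rewrite normrM ler_piMr// ger0_norm ?exprn_ge0 ?(ltW th0).
case=> [//|i]; rewrite ltnS; apply: (IH (a \o succn)) => th /andP[th0 th1] /=.
have := H th; rewrite th0 th1 => /(_ isT); rewrite E a0 add0r.
by rewrite normrM gtr0_norm// exprS mulrCA ler_pM2l.
Qed.

Section moments.
Context (R : realType) d (Om : measurableType d) (P : probability Om R).
Implicit Types X Y : Om -> R.

(** A class closed under sums and products, so that the Gaussian computations need no separate
    integrability arguments. *)
Definition all_moments X := measurable_fun setT X /\
  forall n, P.-integrable setT (EFin \o (fun w => `|X w| ^+ n)).

Lemma all_moments_measurable X : all_moments X -> measurable_fun setT X.
Proof. by case. Qed.

Lemma dominated_integrable X Y : measurable_fun setT X ->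
  (forall w, `|X w| <= Y w) -> P.-integrable setT (EFin \o Y) ->
  P.-integrable setT (EFin \o X).
Proof.
move=> mX XY iY; apply: (le_integrable _ _ _ iY) => //.
  exact/measurable_EFinP.
by move=> w _ /=; rewrite lee_fin (le_trans (XY w))// ler_norm.
Qed.

Lemma all_moments_integrable X : all_moments X -> P.-integrable setT (EFin \o X).
Proof.
move=> [mX /(_ 1%N) iX]; by apply: dominated_integrable iX.
Qed.

Lemma all_moments_cst c : all_moments (fun=> c).
Proof.
split=> [//|n]; exact: finite_measure_integrable_cst.
Qed.

Lemma all_momentsM X Y : all_moments X -> all_moments Y ->
  all_moments (fun w => X w * Y w).
Proof.
move=> [mX iX] [mY iY]; split=> [|n]; first exact: measurable_funM.
apply: (@dominated_integrable _ (fun w => `|X w| ^+ (n * 2) + `|Y w| ^+ (n * 2))).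
- apply: measurable_funX; apply: measurableT_comp => //; exact: measurable_funM.
- move=> w; rewrite ger0_norm ?exprn_ge0// normrM exprMn !exprM.
  set x := _ ^+ n; set y := _ ^+ n.
  have x0 : 0 <= x by rewrite exprn_ge0.
  have y0 : 0 <= y by rewrite exprn_ge0.
  have := sqr_ge0 (x - y); have := mulr_ge0 x0 y0; rewrite sqrrB !expr2; lra.
- by apply: (@integrableD _ _ _ _ _ _ (fun w => (`|X w| ^+ (n * 2))%:E)
    (fun w => (`|Y w| ^+ (n * 2))%:E)); [|exact: iX|exact: iY].
Qed.

Lemma all_momentsD X Y : all_moments X -> all_moments Y ->
  all_moments (fun w => X w + Y w).
Proof.
move=> [mX iX] [mY iY]; split=> [|n]; first exact: measurable_funD.
apply: (@dominated_integrable _ (fun w => 2 ^+ n * (`|X w| ^+ n + `|Y w| ^+ n))).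
- apply: measurable_funX; apply: measurableT_comp => //; exact: measurable_funD.
- move=> w; rewrite ger0_norm ?exprn_ge0//.
  apply: (@le_trans _ _ ((2 * Num.max `|X w| `|Y w|) ^+ n)).
    rewrite lerXn2r ?nnegrE ?mulr_ge0// ?le_max ?normr_ge0//.
    apply: le_trans (ler_normD _ _) _; rewrite mulrDl mul1r lerD// le_max lexx ?orbT//.
  rewrite exprMn ler_wpM2l ?exprn_ge0//; have [_|_] := leP `|X w| `|Y w|.
    by rewrite lerDr exprn_ge0.
  by rewrite lerDl exprn_ge0.
- apply: (@integrableZl _ _ _ _ _ measurableT _ (fun w => (`|X w| ^+ n + `|Y w| ^+ n)%:E)).
  by apply: (@integrableD _ _ _ _ _ _ (fun w => (`|X w| ^+ n)%:E)
    (fun w => (`|Y w| ^+ n)%:E)); [|exact: iX|exact: iY].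
Qed.

Lemma all_momentsZ c X : all_moments X -> all_moments (fun w => c * X w).
Proof. by apply: all_momentsM; exact: all_moments_cst. Qed.

Lemma all_moments_sum (I : Type) (r : seq I) (Q : pred I) (F : I -> Om -> R) :
  (forall i, all_moments (F i)) -> all_moments (fun w => \sum_(i <- r | Q i) F i w).
Proof.
move=> HF; elim: r => [|i r IH].
  by under eq_fun do rewrite big_nil; exact: all_moments_cst.
under eq_fun do rewrite big_cons; case: (Q i) => //.
exact: all_momentsD.
Qed.

Lemma all_moments_prod (I : Type) (r : seq I) (Q : pred I) (F : I -> Om -> R) :
  (forall i, all_moments (F i)) -> all_moments (fun w => \prod_(i <- r | Q i) F i w).
Proof.
move=> HF; elim: r => [|i r IH].
  by under eq_fun do rewrite big_nil; exact: all_moments_cst.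
under eq_fun do rewrite big_cons; case: (Q i) => //.
exact: all_momentsM.
Qed.

Lemma all_momentsX X n : all_moments X -> all_moments (fun w => X w ^+ n).
Proof.
move=> HX; elim: n => [|n IH]; first by under eq_fun do rewrite expr0; exact: all_moments_cst.
by under eq_fun do rewrite exprS; exact: all_momentsM.
Qed.

Definition Ex X : R := \int[P]_w X w.

Lemma Ex_cst c : Ex (fun=> c) = c.
Proof. by rewrite /Ex Rintegral_cst//= probability_setT mulr1. Qed.

Lemma ExD X Y : all_moments X -> all_moments Y ->
  Ex (fun w => X w + Y w) = Ex X + Ex Y.
Proof.
by move=> /all_moments_integrable iX /all_moments_integrable iY; exact: RintegralD.
Qed.

Lemma ExZ c X : all_moments X -> Ex (fun w => c * X w) = c * Ex X.
Proof. by move=> /all_moments_integrable iX; exact: RintegralZl. Qed.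

Lemma Ex_sum (I : Type) (r : seq I) (Q : pred I) (F : I -> Om -> R) :
  (forall i, all_moments (F i)) ->
  Ex (fun w => \sum_(i <- r | Q i) F i w) = \sum_(i <- r | Q i) Ex (F i).
Proof.
move=> HF; elim: r => [|i r IH].
  by under eq_fun do rewrite big_nil; rewrite Ex_cst big_nil.
under eq_fun do rewrite big_cons; rewrite big_cons; case: ifP => // _.
by rewrite ExD ?IH//; exact: all_moments_sum.
Qed.

Lemma Ex_EFin X : all_moments X -> (\int[P]_w (X w)%:E)%E = (Ex X)%:E.
Proof.
move=> /all_moments_integrable iX; rewrite fineK//.
exact: integrable_fin_num.
Qed.

(** As [phi] takes real values, exponentials of every order are integrable. *)
Definition mgf_is X (phi : R -> R) :=
  forall th, (\int[P]_w (expR (th * X w))%:E)%E = (phi th)%:E.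

Section mgf.
Variables (X : Om -> R) (phi : R -> R).
Hypothesis mX : measurable_fun setT X.
Hypothesis HX : mgf_is X phi.

Let mexp th : measurable_fun setT (fun w => expR (th * X w)).
Proof. by apply: measurableT_comp => //; exact: measurable_funM. Qed.

Let iexp th : P.-integrable setT (EFin \o (fun w => expR (th * X w))).
Proof.
apply/integrableP; split; first exact/measurable_EFinP.
under eq_integral do rewrite /= ger0_norm ?expR_ge0//.
by rewrite HX ltry.
Qed.

Let Ex_exp th : Ex (fun w => expR (th * X w)) = phi th.
Proof. by rewrite /Ex /Rintegral HX. Qed.

Let pow_le_exp n (x : R) : 0 <= x -> x ^+ n <= n`!%:R * expR x.
Proof.
move=> x0; case: n => [|n].
  by rewrite expr0 fact0 mul1r -expR0 ler_expR.
have := expR_ge1Dxn n x0; set f := (n.+1`!)%:R : R => h.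
have f0 : 0 < f by rewrite ltr0n fact_gt0.
rewrite mulrC -ler_pdivrMr//; apply: le_trans h; lra.
Qed.

Let exp_abs_le (c x : R) : 0 <= c -> expR (c * `|x|) <= expR (c * x) + expR (- c * x).
Proof.
move=> c0; have [x0|x0] := leP 0 x.
  by rewrite ger0_norm// lerDl expR_ge0.
by rewrite ltr0_norm// mulNr mulrN lerDr expR_ge0.
Qed.

Lemma mgf_all_moments : all_moments X.
Proof.
split=> // n.
apply: (@dominated_integrable _ (fun w => n`!%:R * (expR (1 * X w) + expR (- 1 * X w)))).
- by apply: measurable_funX; apply: measurableT_comp.
- move=> w; rewrite ger0_norm ?exprn_ge0//; apply: le_trans (pow_le_exp n _) _ => //.
  by rewrite ler_wpM2l// -{1}[`|X w|]mul1r exp_abs_le.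
- apply: (@integrableZl _ _ _ _ _ measurableT _
    (fun w => (expR (1 * X w) + expR (- 1 * X w))%:E)).
  by apply: (@integrableD _ _ _ _ _ _ (fun w => (expR (1 * X w))%:E)
    (fun w => (expR (- 1 * X w))%:E)); [|exact: iexp|exact: iexp].
Qed.

Lemma mgf_taylor n : exists c, forall th, 0 < th <= 1 ->
  `|phi th - \sum_(j < n) th ^+ j * (Ex (fun w => X w ^+ j) / j`!%:R)| <= c * th ^+ n.
Proof.
(* [D] dominates [|X| ^+ n * expR (th * |X|)] for [th <= 1]: the power is at most n! times
   [expR |X|], and the two signs together bound [expR (2 * |X|)]. *)
pose D w := n`!%:R * (expR (2 * X w) + expR (- 2 * X w)).
have iD : P.-integrable setT (EFin \o D).
  apply: (@integrableZl _ _ _ _ _ measurableT _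
    (fun w => (expR (2 * X w) + expR (- 2 * X w))%:E)).
  by apply: (@integrableD _ _ _ _ _ _ (fun w => (expR (2 * X w))%:E)
    (fun w => (expR (- 2 * X w))%:E)); [|exact: iexp|exact: iexp].
have HM := mgf_all_moments.
exists (\int[P]_w D w) => th /andP[th0 th1].
pose T w := \sum_(j < n) (th ^+ j / j`!%:R) * X w ^+ j.
have HT : all_moments T by apply: all_moments_sum => j; exact/all_momentsZ/all_momentsX.
have -> : \sum_(j < n) th ^+ j * (Ex (fun w => X w ^+ j) / j`!%:R) = Ex T.
  rewrite Ex_sum => [|j]; last exact/all_momentsZ/all_momentsX.
  by apply: eq_bigr => j _; rewrite ExZ ?mulrA 1?mulrAC//; exact: all_momentsX.
rewrite -Ex_exp /Ex -RintegralB//; last exact: all_moments_integrable.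
have iB : P.-integrable setT (EFin \o (fun w => expR (th * X w) - T w)).
  apply: (@integrableB _ _ _ _ _ _ (fun w => (expR (th * X w))%:E)
    (fun w => (T w)%:E)) => //; first exact: iexp.
  exact: all_moments_integrable.
apply: le_trans (le_normr_Rintegral _ iB) _ => //.
have iDth : P.-integrable setT (EFin \o (fun w => th ^+ n * D w)).
  exact: (@integrableZl _ _ _ _ _ measurableT _ (fun w => (D w)%:E)).
rewrite mulrC -RintegralZl//; apply: le_Rintegral => //; first exact: integrable_norm.
move=> w _; have -> : T w = \sum_(j < n) (th * X w) ^+ j / j`!%:R.
  by apply: eq_bigr => j _; rewrite exprMn mulrAC.
apply: le_trans (expR_taylor _ _) _.
rewrite normrM gtr0_norm// exprMn -mulrA ler_wpM2l ?exprn_ge0 ?(ltW th0)//.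
apply: (@le_trans _ _ (n`!%:R * expR (2 * `|X w|))).
  rewrite mulrDl mul1r expRD mulrA ler_pM ?exprn_ge0 ?expR_ge0//; first exact: pow_le_exp.
  by rewrite ler_expR ler_piMl.
by rewrite /D ler_wpM2l// exp_abs_le.
Qed.

End mgf.

(** For even [n] this equals (n - 1)!! times [v ^+ n./2]; it is n! times the coefficient of
    [th ^+ n] in [expR (th ^+ 2 * (v / 2))]. *)
Definition gauss_moment (v : R) n : R :=
  if odd n then 0 else (n`!)%:R * (v / 2) ^+ n./2 / (n./2`!)%:R.

(** The Taylor polynomial built from the moments and the one of the Gaussian exponential differ from
    the same function by the order of truncation, so their lower coefficients agree. *)
Lemma gauss_moments X v : 0 <= v -> measurable_fun setT X ->
  mgf_is X (fun th => expR (th ^+ 2 * (v / 2))) ->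
  forall n, Ex (fun w => X w ^+ n) = gauss_moment v n.
Proof.
move=> v0 mX HX n.
(* The order [K * 2] exceeds [n], and it is even because the Gaussian exponential expands in powers
   of [th ^+ 2]. *)
pose K := n.+1.
have [c Hc] := mgf_taylor mX HX (K * 2).
pose b i : R := if odd i then 0 else (v / 2) ^+ i./2 / (i./2`!)%:R.
pose a i := Ex (fun w => X w ^+ i) / i`!%:R - b i.
have bE th k : \sum_(i < k * 2) b i * th ^+ i =
    \sum_(j < k) (th ^+ 2 * (v / 2)) ^+ j / j`!%:R.
  elim: k => [|k IH]; first by rewrite !big_ord0.
  rewrite mulSn add2n !big_ord_recr /= IH /b /= muln2 odd_double /= doubleK mul0r addr0.
  congr (_ + _); move: (v / 2) => u.
  by rewrite exprMn -mul2n (exprM th 2) mulrAC [u ^+ k * _]mulrC.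
have : a n = 0.
  pose c' := c + (v / 2) ^+ K * expR (v / 2).
  apply: (@coef_eq0_near0 _ (K * 2) a c'); last first.
    by rewrite muln2 -addnn ltn_addr.
  move=> th th01; have := Hc th th01; case/andP: th01 => th0 th1.
  have v20 : 0 <= v / 2 by rewrite divr_ge0.
  have q0 : 0 <= th ^+ 2 * (v / 2) by rewrite mulr_ge0 ?exprn_ge0// ltW.
  have := expR_taylor K (th ^+ 2 * (v / 2)).
  rewrite (ger0_norm q0) -bE; set e := expR _; set S1 := \sum_(_ < _) _.
  move=> h1; set S2 := \sum_(_ < _) _ => h2.
  have -> : \sum_(i < K * 2) a i * th ^+ i = (e - S1) - (e - S2).
    rewrite [RHS](_ : _ = S2 - S1); last by ring.
    rewrite /S1 /S2 -sumrB.
    by apply: eq_bigr => i _; rewrite /a mulrBl; congr (_ - _); rewrite mulrC.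
  apply: le_trans (ler_normB _ _) _; rewrite /c' mulrDl addrC; apply: lerD => //.
  apply: le_trans h1 _.
  have -> : (th ^+ 2 * (v / 2)) ^+ K = (v / 2) ^+ K * th ^+ (K * 2).
    by move: (v / 2) => u; rewrite exprMn -exprM mulnC mulrC.
  rewrite mulrAC ler_wpM2r ?exprn_ge0 ?(ltW th0)// ler_wpM2l ?exprn_ge0//.
  by rewrite /e ler_expR ler_piMl// exprn_ile1// ltW.
rewrite /a => /eqP; rewrite subr_eq0 => /eqP h.
have f0 : (n`!)%:R != 0 :> R by rewrite pnatr_eq0 -lt0n fact_gt0.
have -> : Ex (fun w => X w ^+ n) = (n`!)%:R * (Ex (fun w => X w ^+ n) / (n`!)%:R).
  by rewrite mulrC divfK.
by rewrite h /b /gauss_moment; case: ifP; rewrite ?mulr0 ?mulrA.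
Qed.

End moments.

(** * Polarization and Wick's formula *)

Section cover_sums.
Local Open Scope set_scope.

(** Inclusion-exclusion, by expanding the product over [i] of 1 minus the indicator of [i] lying
    outside [A]; the set [S] records where the term 1 is chosen. *)
Lemma sum_cover_sign (R : comNzRingType) (n : nat) (A : {set 'I_n}) :
  \sum_(S : {set 'I_n} | A \subset S) (-1) ^+ #|~: S| = (A == [set: 'I_n])%:R :> R.
Proof.
transitivity (\prod_(i : 'I_n) (1 + - (i \notin A)%:R) : R).
  rewrite bigA_distr [RHS](bigID (fun S : {set 'I_n} => A \subset S)) /=.
  rewrite [X in _ = _ + X]big1 ?addr0.
    apply: eq_bigr => S AS; rewrite (bigID (mem S)) /= big1; last by move=> i ->.
    rewrite mul1r -prodr_const; apply: eq_big => [i|i]; first by rewrite inE.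
    rewrite inE => iS; rewrite (negbTE iS); congr (- _).
    by case: (boolP (i \in A)) => // iA; rewrite (fintype.subsetP AS _ iA) in iS.
  move=> S /fintype.subsetPn[i iA iS]; rewrite (bigD1 i)//= (negbTE iS) iA /= oppr0.
  by rewrite mul0r.
have [->|] := eqVneq A [set: 'I_n].
  by rewrite big1// => i _; rewrite inE oppr0 addr0.
rewrite -finset.properT => /properP[_ [i _ iA]].
by rewrite (bigD1 i)//= iA subrr mul0r.
Qed.

(** The support is abstract because there are two uses: self-maps of the index set with their image,
    and families of pairs with [pairing_support]. *)
Lemma sum_cover (R : comNzRingType) (n : nat) (F : finType)
    (supp : F -> {set 'I_n}) (phi : F -> R) :
  \sum_(S : {set 'I_n}) (-1) ^+ #|~: S| * \sum_(f | supp f \subset S) phi f =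
  \sum_(f | supp f == [set: 'I_n]) phi f.
Proof.
under eq_bigr do rewrite mulr_sumr.
rewrite (exchange_big_dep xpredT)//= [RHS]big_mkcond; apply: eq_bigr => f _.
rewrite -mulr_suml sum_cover_sign; case: eqP; by rewrite ?mul1r ?mul0r.
Qed.

Lemma sum_expr_ffun (R : comNzRingType) (I : finType) (Q : pred I) (F : I -> R) k :
  (\sum_(i | Q i) F i) ^+ k =
  \sum_(f : {ffun 'I_k -> I} | [forall j, Q (f j)]) \prod_(j < k) F (f j).
Proof.
rewrite -[k in LHS]card_ord -prodr_const bigA_distr_big.
by apply: eq_bigl => f; apply/ffun_onP/forallP => H j; exact: H.
Qed.

(** The cardinal counts the surjective self-maps, that is, the permutations. It is left unevaluated,
    as the comparison of expectations only needs its positivity. *)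
Lemma polarization (R : comNzRingType) (n : nat) (y : 'I_n -> R) :
  \sum_(S : {set 'I_n}) (-1) ^+ #|~: S| * (\sum_(i in S) y i) ^+ n =
  #|[set f : {ffun 'I_n -> 'I_n} | f @: [set: 'I_n] == [set: 'I_n]]|%:R * \prod_i y i.
Proof.
transitivity (\sum_(f : {ffun 'I_n -> 'I_n} | f @: [set: 'I_n] == [set: 'I_n])
  \prod_j y (f j)).
  rewrite -sum_cover; apply: eq_bigr => S _; congr (_ * _).
  rewrite sum_expr_ffun; apply: eq_bigl => f; apply/forallP/fintype.subsetP.
    by move=> H _ /imsetP[j _ ->].
  by move=> H j; apply: H; exact: imset_f.
rewrite -sum1dep_card natr_sum mulr_suml; apply: eq_bigr => f /eqP ft.
have finj : injective f.
  have /imset_injP H : #|f @: [set: 'I_n]| == #|[set: 'I_n]| by rewrite ft.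
  by move=> i j; apply: H; rewrite inE.
by rewrite mul1r [RHS](reindex_inj finj).
Qed.

End cover_sums.

Section wick.
Local Open Scope set_scope.
Context (R : realType) d (Om : measurableType d) (P : probability Om R).
Variable n : nat.
Implicit Types (Y : 'I_n -> Om -> R) (K : 'I_n -> 'I_n -> R).

(** A weak form of being jointly Gaussian and centered with covariance [K]: only subset sums are
    tested, which is all that polarization requires. *)
Definition gaussian_family Y K := forall S : {set 'I_n},
  mgf_is P (fun w => \sum_(i in S) Y i w)
    (fun th => expR (th ^+ 2 * ((\sum_(i in S) \sum_(j in S) K i j) / 2))).

(** When [k] is half of an even [n], full support forces the [k] pairs to be disjoint and without
    repetition: [f] is then a pairing with an order on the pairs and within each pair. *)
Definition pairing_support k (f : {ffun 'I_k -> 'I_n * 'I_n}) : {set 'I_n} :=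
  \bigcup_j [set (f j).1; (f j).2].

(** Polarization reduces the product to powers of subset sums, whose moments are powers of sums of
    covariances; [sum_cover] then keeps the families of pairs that use every index. The divisors
    account for the orders on and within the pairs. *)
Lemma wick Y K : (forall i, all_moments P (Y i)) -> (forall i j, 0 <= K i j) ->
  gaussian_family Y K ->
  #|[set f : {ffun 'I_n -> 'I_n} | f @: [set: 'I_n] == [set: 'I_n]]|%:R *
    Ex P (fun w => \prod_i Y i w) =
  if odd n then 0 else (n`!)%:R / (n./2`!)%:R / 2 ^+ n./2 *
    \sum_(f : {ffun 'I_(n./2) -> 'I_n * 'I_n} | pairing_support f == [set: 'I_n])
      \prod_j K (f j).1 (f j).2.
Proof.
move=> MY K0 HY.
have MS (S : {set 'I_n}) : all_moments P (fun w => \sum_(i in S) Y i w) by exact: all_moments_sum.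
rewrite -ExZ; last exact: all_moments_prod.
rewrite (_ : (fun w => _) = fun w => \sum_(S : {set 'I_n})
    (-1) ^+ #|~: S| * (\sum_(i in S) Y i w) ^+ n); last first.
  by apply/funext => w; rewrite polarization.
rewrite Ex_sum => [|S]; last exact/all_momentsZ/all_momentsX.
have E (S : {set 'I_n}) : Ex P (fun w => (-1) ^+ #|~: S| * (\sum_(i in S) Y i w) ^+ n) =
    (-1) ^+ #|~: S| * gauss_moment (\sum_(i in S) \sum_(j in S) K i j) n.
  rewrite ExZ; last exact: all_momentsX.
  congr (_ * _).
  have v0 : 0 <= \sum_(i in S) \sum_(j in S) K i j.
    by apply: sumr_ge0 => i _; exact: sumr_ge0.
  have h := gauss_moments v0 (all_moments_measurable (MS S)) (HY S).
  exact: (h n).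
under eq_bigr do rewrite E; rewrite /gauss_moment; case: ifP => _.
  by rewrite big1// => S _; rewrite mulr0.
rewrite -sum_cover mulr_sumr; apply: eq_bigr => S _.
rewrite [RHS]mulrCA; congr (_ * _).
rewrite exprMn exprVn mulrA -[RHS]mulrA.
set f1 := (n`!)%:R; set f2 := (n./2`!)%:R.
have -> : \sum_(i in S) \sum_(j in S) K i j =
    \sum_(p : 'I_n * 'I_n | (p.1 \in S) && (p.2 \in S)) K p.1 p.2.
  by rewrite pair_big.
rewrite sum_expr_ffun; set Q := \sum_(_ | _) _; set Q' := \sum_(_ | _) _.
have -> : Q = Q'.
  apply: eq_bigl => f; apply/forallP/bigcupsP => H j.
    by move=> _; apply/fintype.subsetP => i; have /andP[? ?] := H j; rewrite !inE => /orP[]/eqP->.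
  have /fintype.subsetP := H j isT => {}H; apply/andP; split; apply: H; rewrite !inE eqxx ?orbT//.
ring.
Qed.

Lemma wick_comparison Y K Y' K' :
  (forall i, all_moments P (Y i)) -> (forall i, all_moments P (Y' i)) ->
  (forall i j, 0 <= K i j <= K' i j) ->
  gaussian_family Y K -> gaussian_family Y' K' ->
  0 <= Ex P (fun w => \prod_i Y i w) <= Ex P (fun w => \prod_i Y' i w).
Proof.
move=> MY MY' KK' HY HY'.
have K0 i j : 0 <= K i j by case/andP: (KK' i j).
have K'0 i j : 0 <= K' i j by case/andP: (KK' i j) => /le_trans h /h.
set c := #|[set f : {ffun 'I_n -> 'I_n} | f @: [set: 'I_n] == [set: 'I_n]]|.
have c0 : 0 < c%:R :> R.
  rewrite ltr0n card_gt0; apply/set0Pn; exists [ffun i => i]; rewrite inE.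
  apply/eqP/setP => i; rewrite !inE; apply/imsetP; exists i => //; by rewrite ffunE.
have q0 : 0 <= (n`!)%:R / (n./2`!)%:R / 2 ^+ n./2 :> R.
  by rewrite !divr_ge0// exprn_ge0.
apply/andP; split.
  rewrite -(pmulr_rge0 _ c0) (wick MY K0 HY); case: ifP => // _.
  by rewrite mulr_ge0// sumr_ge0// => f _; exact: prodr_ge0.
rewrite -(ler_pM2l c0) (wick MY K0 HY) (wick MY' K'0 HY'); case: ifP => // _.
by rewrite ler_wpM2l//; apply: ler_sum => f _; apply: ler_prod => j _; exact: KK'.
Qed.

End wick.

(** * Independence and increments of fractional Brownian motion *)

Section independence.
Context (R : realType) d (Om : measurableType d) (P : probability Om R).
Variables (n : nat) (U : 'I_n -> Om -> R).
Hypothesis mU : forall i, measurable_fun setT (U i).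
Hypothesis indepU : forall A : 'I_n -> set R, (forall i, measurable (A i)) ->
  P (\bigcap_i (U i @^-1` A i)) = (\prod_i P (U i @^-1` A i))%E.

(* The functions of index at least [m] are indicators; the induction on [m]
   trades these indicators for arbitrary functions one at a time. *)
Let indep_prod_aux m (g : 'I_n -> R -> R) (e : 'I_n -> R) : (m <= n)%N ->
  (forall i, measurable_fun setT (g i)) -> (forall i x, 0 <= g i x) ->
  (forall i, \int[P]_w (g i (U i w))%:E = (e i)%:E)%E ->
  (forall i : 'I_n, (m <= i)%N -> exists2 A, measurable A & g i = \1_A) ->
  (\int[P]_w (\prod_i g i (U i w))%:E = (\prod_i e i)%:E)%E.
Proof.
have pre i (A : set R) : measurable A -> measurable (U i @^-1` A).
  by move=> mA; rewrite -[_ @^-1` _]setTI; exact: mU.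
elim: m g e => [|m IH] g e mn mg g0 He gA.
  have /choice[A HA] : forall i, exists A, measurable A /\ g i = \1_A.
    by move=> i; have [A ? ?] := gA i (leq0n _); exists A.
  have -> : (fun w => (\prod_i g i (U i w))%:E) =
      (fun w => (\1_(\bigcap_i (U i @^-1` A i)) w)%:E).
    apply/funext => w; congr EFin.
    have [h|h] := pselect ((\bigcap_i (U i @^-1` A i)) w).
      rewrite indicE mem_set// big1// => i _; rewrite (HA i).2 indicE mem_set//.
      exact: h.
    rewrite indicE memNset//.
    have [i nAi] : exists i, ~ A i (U i w).
      by apply/existsNP => hA; apply: h => i _; exact: hA.
    by rewrite (bigD1 i)//= (HA i).2 indicE memNset// mul0r.
  rewrite integral_indic ?setIT//; last first.
    by apply: fin_bigcap_measurable => // i _; apply: pre; exact: (HA i).1.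
  transitivity (\prod_i P (U i @^-1` A i))%E.
    by apply: indepU => i; exact: (HA i).1.
  rewrite -prodEFin; apply: eq_bigr => i _; rewrite -He (HA i).2.
  rewrite [RHS](_ : _ = \int[P]_w (\1_(U i @^-1` A i) w)%:E)%E//.
  by rewrite integral_indic ?setIT//; apply: pre; exact: (HA i).1.
pose i0 := Ordinal mn.
pose W w := \prod_(i | i != i0) g i (U i w).
pose C := \prod_(i | i != i0) e i.
have e0 i : 0 <= e i.
  by rewrite -lee_fin -He; apply: integral_ge0 => w _; rewrite lee_fin.
have C0 : 0 <= C by exact: prodr_ge0.
have mgU i : measurable_fun setT (fun w => g i (U i w)) by exact: measurableT_comp.
have mW : measurable_fun setT W.
  by rewrite /W; under eq_fun do rewrite -big_filter; exact: measurable_prod.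
transitivity (\int[P]_w (g i0 (U i0 w) * W w)%:E)%E.
  by apply: eq_integral => w _; rewrite (bigD1 i0).
(* Against indicators of [U i0] the weights [W] and [C] have equal integrals by the induction
   hypothesis; [weighted_transfer] extends this to [g i0]. *)
transitivity (\int[P]_w (g i0 (U i0 w) * C)%:E)%E.
  apply: (@weighted_transfer R _ _ _ _ _ _ P P (U i0) (U i0) W (fun=> C)) => //.
    by move=> w; exact: prodr_ge0.
  move=> A mA; pose g' i := if i == i0 then \1_A else g i.
  pose e' i := if i == i0 then fine (P (U i0 @^-1` A)) else e i.
  have PA : (\int[P]_w (\1_A (U i0 w))%:E = (fine (P (U i0 @^-1` A)))%:E)%E.
    rewrite [LHS](_ : _ = \int[P]_w (\1_(U i0 @^-1` A) w)%:E)%E//.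
    rewrite integral_indic ?setIT//; last exact: pre.
    by rewrite fineK// fin_num_measure//; exact: pre.
  have Ee' : \prod_i e' i = fine (P (U i0 @^-1` A)) * C.
    rewrite (bigD1 i0)//= {1}/e' eqxx; congr (_ * _).
    by apply: eq_bigr => i /negbTE ni; rewrite /e' ni.
  have := IH g' e' (ltnW mn) _ _ _ _; rewrite Ee'.
  have -> : (fun w => (\prod_i g' i (U i w))%:E) = (fun w => (\1_A (U i0 w) * W w)%:E).
    apply/funext => w; rewrite (bigD1 i0)//= {1}/g' eqxx; congr (_ * _)%:E.
    by apply: eq_bigr => i /negbTE ni; rewrite /g' ni.
  move=> ->.
  - under [RHS]eq_integral do rewrite EFinM.
    rewrite ge0_integralZr ?lee_fin//.
    + by rewrite PA.
    + apply/measurable_EFinP.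
      have mi : measurable_fun setT (\1_A : R -> R) by exact: measurable_indic.
      exact: measurableT_comp mi (mU i0).
  - by move=> i; rewrite /g'; case: eqP => _; [exact: measurable_indic|exact: mg].
  - by move=> i x; rewrite /g'; case: eqP => _; [rewrite indicE|exact: g0].
  - by move=> i; rewrite /g' /e'; case: eqP => [->|_]; [exact: PA|exact: He].
  - move=> i mi; rewrite /g'; case: eqP => [_|ni]; first by exists A.
    apply: gA; rewrite ltn_neqAle mi andbT; apply/eqP => im; apply: ni.
    exact/val_inj.
under eq_integral do rewrite EFinM.
rewrite ge0_integralZr ?lee_fin//.
- by rewrite He -EFinM [RHS](_ : _ = (e i0 * C)%:E)%E// (bigD1 i0).
- exact/measurable_EFinP.
- by move=> w _; rewrite lee_fin.
Qed.

Lemma indep_prod_integral (g : 'I_n -> R -> R) (e : 'I_n -> R) :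
  (forall i, measurable_fun setT (g i)) -> (forall i x, 0 <= g i x) ->
  (forall i, \int[P]_w (g i (U i w))%:E = (e i)%:E)%E ->
  (\int[P]_w (\prod_i g i (U i w))%:E = (\prod_i e i)%:E)%E.
Proof.
move=> mg g0 He; apply: (@indep_prod_aux n) => // i ni.
by have := ltn_ord i; rewrite ltnNge ni.
Qed.

End independence.

Section fbm_increments.
Context (R : realType) d (Om : measurableType d) (P : probability Om R).
Variable H : R.

(** The covariance of the increments over [[u, v]] and [[u', v']], in which the one-point powers
    have cancelled. *)
Definition incr_cov (u v u' v' : R) : R :=
  2^-1 * (`|v - u'| `^ (2 * H) + `|u - v'| `^ (2 * H)
          - `|v - v'| `^ (2 * H) - `|u - u'| `^ (2 * H)).

Section one_process.
Variable X : R -> {RV P >-> R}.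
Hypothesis hX : fbm1 H X.

Lemma fbm1_comb_mgf n (c a : 'I_n -> R) : (forall j, 0 <= a j) ->
  exists m v : R, 0 <= v /\
   mgf_is P (fun w => \sum_(j < n) c j * X (a j) w)
     (fun th => expR (th * m + th ^+ 2 * (v / 2))).
Proof.
move=> a0; have [m [v [v0 Hmv]]] : exists m v : R, 0 <= v /\ forall th : R,
    (\int[P]_w (expR (th * \sum_(j < n) c j * X (a j) w))%:E =
    (expR (th * m + th ^+ 2 * (v / 2)))%:E)%E.
  apply: gaussian_mgf; last exact: (fbm1_gaussian hX).
  by apply: measurable_sum => j; exact: measurable_funM.
by exists m, v.
Qed.

Lemma fbm1_all_moments a : 0 <= a -> all_moments P (X a).
Proof.
move=> a0; have [m [v [_ Hmv]]] := @fbm1_comb_mgf 1 (fun=> 1) (fun=> a) (fun=> a0).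
have := mgf_all_moments (P := P) _ Hmv.
under eq_fun do rewrite big_ord1 mul1r.
by apply.
Qed.

Lemma fbm1_Ex a : 0 <= a -> Ex P (X a) = 0.
Proof.
move=> a0; have := fbm1_centered hX a0; rewrite unlock.
by rewrite Ex_EFin; [move=> -[]|exact: fbm1_all_moments].
Qed.

Lemma fbm1_Ex_mul a b : 0 <= a -> 0 <= b -> Ex P (fun w => X a w * X b w) =
  2^-1 * (a `^ (2 * H) + b `^ (2 * H) - `|a - b| `^ (2 * H)).
Proof.
move=> a0 b0; have := fbm1_covariance hX a0 b0; rewrite unlock.
by rewrite Ex_EFin; [move=> -[]|apply: all_momentsM; exact: fbm1_all_moments].
Qed.

Lemma all_moments_incr u v : 0 <= u -> 0 <= v -> all_moments P (fun w => X v w - X u w).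
Proof.
move=> u0 v0; under eq_fun do rewrite -mulN1r.
by apply: all_momentsD; [|apply: all_momentsZ]; exact: fbm1_all_moments.
Qed.

Lemma Ex_incr_mul u v u' v' : 0 <= u -> 0 <= v -> 0 <= u' -> 0 <= v' ->
  Ex P (fun w => (X v w - X u w) * (X v' w - X u' w)) = incr_cov u v u' v'.
Proof.
move=> u0 v0 u'0 v'0.
have M a b : 0 <= a -> 0 <= b -> all_moments P (fun w => X a w * X b w).
  by move=> a0 b0; apply: all_momentsM; exact: fbm1_all_moments.
rewrite (_ : (fun w => _) = (fun w => X v w * X v' w + (- 1 * (X v w * X u' w) +
   (- 1 * (X u w * X v' w) + X u w * X u' w)))); last by apply/funext => w; ring.
rewrite !ExD ?ExZ ?fbm1_Ex_mul //; first by rewrite /incr_cov; ring.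
all: repeat first [exact: M | apply: all_momentsZ | apply: all_momentsD].
Qed.

(** Gaussianity only provides some mean [m] and some variance [q]; the first two moments, computed
    from the covariance of the process, identify them. *)
Lemma incr_comb_mgf n (c u v : 'I_n -> R) :
  (forall l, 0 <= u l) -> (forall l, 0 <= v l) ->
  mgf_is P (fun w => \sum_(l < n) c l * (X (v l) w - X (u l) w))
   (fun th => expR (th ^+ 2 *
     ((\sum_(l < n) \sum_(m < n) c l * c m * incr_cov (u l) (v l) (u m) (v m)) / 2))).
Proof.
move=> u0 v0; set Q := \sum_(l < n) _.
pose Z w := \sum_(l < n) c l * (X (v l) w - X (u l) w).
have MZl l : all_moments P (fun w => c l * (X (v l) w - X (u l) w)).
  exact/all_momentsZ/all_moments_incr.
have MZ : all_moments P Z by exact: all_moments_sum.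
have [m [q [q0 Hmq]]] : exists m q : R, 0 <= q /\
    mgf_is P Z (fun th => expR (th * m + th ^+ 2 * (q / 2))).
  (* A combination of increments is one of [n + n] values: the ends [v l] with coefficients [c l],
     the ends [u l] with [- c l]. *)
  have [|m [q [q0 Hmq]]] := @fbm1_comb_mgf (n + n)
     (fun j => match fintype.split j with inl l => c l | inr l => - c l end)
     (fun j => match fintype.split j with inl l => v l | inr l => u l end).
    by move=> j; case: (fintype.split j).
  exists m, q; split=> // th; rewrite -Hmq; apply: eq_integral => w _.
  congr (expR (_ * _))%:E; rewrite big_split_ord /= -big_split /=.
  apply: eq_bigr => l _.
  have -> : fintype.split (lshift n l) = inl l by exact: (unsplitK (inl l)).
  have -> : fintype.split (rshift n l) = inr l by exact: (unsplitK (inr l)).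
  by ring.
(* The moment formula concerns centered variables, so [Z] is first recentred by the unknown [m]. *)
have HW : mgf_is P (fun w => Z w - m) (fun th => expR (th ^+ 2 * (q / 2))).
  move=> th; transitivity (\int[P]_w ((expR (- (th * m)))%:E * (expR (th * Z w))%:E))%E.
    by apply: eq_integral => w _; rewrite -EFinM -expRD; congr (expR _)%:E; ring.
  rewrite ge0_integralZl//.
  - by rewrite Hmq -EFinM -expRD; congr (expR _)%:E; ring.
  - apply/measurable_EFinP/measurableT_comp => //; apply: measurable_funM => //.
    exact: all_moments_measurable MZ.
have MW : all_moments P (fun w => Z w - m).
  by apply: all_momentsD => //; exact: all_moments_cst.
have mom := gauss_moments q0 (all_moments_measurable MW) HW.
have EZ : Ex P Z = 0.
  rewrite Ex_sum// big1// => l _; rewrite ExZ; last exact: all_moments_incr.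
  rewrite (_ : (fun w => X (v l) w - X (u l) w) = (fun w => X (v l) w + (-1) * X (u l) w)).
    rewrite ExD ?ExZ ?fbm1_Ex ?mulr0 ?addr0 ?mulr0//; first exact: fbm1_all_moments.
    - exact: fbm1_all_moments.
    - by apply: all_momentsZ; exact: fbm1_all_moments.
  by apply/funext => w; rewrite mulN1r.
have m0 : m = 0.
  have := mom 1%N; rewrite /gauss_moment /=; under eq_fun do rewrite expr1.
  rewrite ExD//; last exact: all_moments_cst.
  by rewrite EZ Ex_cst add0r => /eqP; rewrite oppr_eq0 => /eqP.
have qQ : q = Q.
  have g2 : gauss_moment q 2 = q.
    rewrite /gauss_moment (_ : 2`! = 2)%N// (_ : (2./2)`! = 1)%N//.
    by rewrite divr1 expr1 mulrC divfK.
  have := mom 2%N; rewrite g2 m0; under eq_fun do rewrite subr0.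
  rewrite (_ : (fun w => Z w ^+ 2) = fun w => \sum_(l < n) \sum_(j < n)
     c l * c j * ((X (v l) w - X (u l) w) * (X (v j) w - X (u j) w))); last first.
    apply/funext => w; rewrite expr2 mulr_suml; apply: eq_bigr => l _.
    by rewrite mulr_sumr; apply: eq_bigr => j _; ring.
  have MM l j : all_moments P (fun w =>
      c l * c j * ((X (v l) w - X (u l) w) * (X (v j) w - X (u j) w))).
    by apply/all_momentsZ/all_momentsM; exact: all_moments_incr.
  rewrite Ex_sum => [|l]; last exact: all_moments_sum.
  rewrite [X in X = _ -> _](_ : _ = Q).
    by move=> ->.
  apply: eq_bigr => l _; rewrite Ex_sum//; apply: eq_bigr => j _.
  rewrite ExZ ?Ex_incr_mul//; apply: all_momentsM; exact: all_moments_incr.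
move=> th; rewrite -qQ; have := Hmq th; rewrite m0 mulr0 add0r; apply.
Qed.

(** Independence is stated on the sigma-algebras generated by the processes; this brings
    combinations of increments within its reach. *)
Lemma incr_comb_sigma n (c u v : 'I_n -> R) (A : set R) :
  (forall l, 0 <= u l) -> (forall l, 0 <= v l) -> measurable A ->
  process_sigma_algebra X
    ((fun w => \sum_(l < n) c l * (X (v l) w - X (u l) w)) @^-1` A).
Proof.
move=> u0 v0 mA; rewrite /process_sigma_algebra; set G := [set B | _].
have mX a : 0 <= a -> measurable_fun setT (X a : g_sigma_algebraType G -> R).
  move=> a0 _ V mV; rewrite setTI; apply: sub_sigma_algebra.
  by exists a, V.
have : measurable_fun setT
   ((fun w => \sum_(l < n) c l * (X (v l) w - X (u l) w)) : g_sigma_algebraType G -> R).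
  apply: measurable_sum => l; apply: measurable_funM => //.
  by apply: measurable_funB; exact: mX.
by move=> /(_ measurableT A mA); rewrite setTI.
Qed.

End one_process.

(** Grouping a subset sum by letters leaves one combination of increments per component.
    Independence multiplies their moment generating functions, so only pairs of equal letters
    contribute to the variance. *)
Lemma fbm_gaussian_family dd (B : 'I_dd -> R -> {RV P >-> R}) n (I : 'I_n -> 'I_dd)
    (u v : 'I_n -> R) :
  fbm H B -> (forall l, 0 <= u l) -> (forall l, 0 <= v l) ->
  gaussian_family P (fun l w => B (I l) (v l) w - B (I l) (u l) w)
    (fun l m => (I l == I m)%:R * incr_cov (u l) (v l) (u m) (v m)).
Proof.
move=> [hB indB] u0 v0 S th.
pose c i l : R := ((l \in S) && (I l == i))%:R.
pose U i w := \sum_(l < n) c i l * (B i (v l) w - B i (u l) w).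
have MU i : all_moments P (U i).
  by apply: all_moments_sum => l; exact/all_momentsZ/(all_moments_incr (hB i)).
transitivity (\int[P]_w (\prod_i expR (th * U i w))%:E)%E.
  apply: eq_integral => w _; rewrite -expR_sum -mulr_sumr; congr (expR (_ * _))%:E.
  rewrite /U exchange_big /= big_mkcond /=; apply: eq_bigr => l _.
  rewrite (bigD1 (I l))//= big1.
    by rewrite /c eqxx andbT addr0; case: (l \in S); rewrite ?mul1r ?mul0r.
  by move=> i /negbTE; rewrite eq_sym /c => ->; rewrite andbF mul0r.
have mgfU i := incr_comb_mgf (hB i) (c i) u0 v0.
rewrite (@indep_prod_integral R _ _ P dd U _ _ (fun i x => expR (th * x))
  (fun i => expR (th ^+ 2 * ((\sum_(l < n) \sum_(m < n)
     c i l * c i m * incr_cov (u l) (v l) (u m) (v m)) / 2)))).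
- congr EFin; rewrite -expR_sum -mulr_sumr -mulr_suml; congr (expR (_ * (_ / 2))).
  rewrite exchange_big /= [RHS]big_mkcond; apply: eq_bigr => l _.
  rewrite exchange_big /=; case: ifP => lS; last first.
    by rewrite big1// => m _; rewrite big1// => i _; rewrite /c lS !mul0r.
  rewrite [RHS]big_mkcond; apply: eq_bigr => m _.
  rewrite (bigD1 (I l))//= big1 ?addr0; last first.
    by move=> i /negbTE; rewrite eq_sym /c => ->; rewrite andbF !mul0r.
  by rewrite /c lS eqxx /= mul1r eq_sym; case: (m \in S); rewrite ?mul0r.
- by move=> i; exact: all_moments_measurable (MU i).
- move=> A mA.
  have := indB [set: 'I_dd]%SET (fun i => U i @^-1` A i).
  rewrite (_ : [set` [set: 'I_dd]%SET] = setT); last first.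
    by apply/seteqP; split=> // i _ /=; rewrite inE.
  rewrite (eq_bigl xpredT) => [|i]; last by rewrite inE.
  by apply=> i _; exact: (incr_comb_sigma (c i) u0 v0 (mA i)).
- by move=> i; apply: measurableT_comp => //; exact: measurable_funM.
- by move=> i x; exact: expR_ge0.
- by move=> i; exact: mgfU.
Qed.

End fbm_increments.

(** * Expectations of the left-point sums *)

(** Convexity of the power at the midpoint of [x - 1] and [x + 1]. With [p := 2 * H] it makes the
    increments over grid intervals nonnegatively correlated. *)
Lemma powR_abs_second_difference (R : realType) (p x : R) : 1 <= p ->
  2 * `|x| `^ p <= `|x + 1| `^ p + `|x - 1| `^ p.
Proof.
move=> p1; have p0 : 0 <= p by exact: le_trans p1.
set y := `|x + 1|; set z := `|x - 1|.
have y0 : 0 <= y by exact: normr_ge0.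
have z0 : 0 <= z by exact: normr_ge0.
have xyz : `|x| <= 2^-1 * y + 2^-1 * z.
  have -> : x = 2^-1 * (x + 1) + 2^-1 * (x - 1) by field.
  apply: le_trans (ler_normD _ _) _.
  by rewrite !normrM ger0_norm ?invr_ge0.
have h : (2^-1 * y + 2^-1 * z) `^ p <= 2^-1 * y `^ p + 2^-1 * z `^ p.
  have -> : (2^-1 : R) * z = (1 - 2^-1) * z by field.
  have -> : (2^-1 : R) * z `^ p = (1 - 2^-1) * z `^ p by field.
  by apply: (convex_powR p1 (Itv01 _ _)) => //=;
    rewrite ?inE/= ?in_itv/= ?andbT ?invr_ge0// invf_le1 ?ler1n.
have := powR_le p0 (normr_ge0 x) xyz; move=> /le_trans/(_ h); lra.
Qed.

Section discrete_sums.
Context (R : realType) d (Om : measurableType d) (P : probability Om R).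
Variables (H : R) (dd : nat) (B : 'I_dd -> R -> {RV P >-> R}).
Hypothesis H_gt : 2^-1 < H.
Hypothesis hB : fbm H B.
Variables (s t : R).
Hypothesis s0 : 0 <= s.
Hypothesis st : s < t.
Variable i0 : 'I_dd.
Variable n : nat.

Let tau := grid_point s t n.

Let tau_ge0 j : 0 <= tau j.
Proof.
rewrite /tau /grid_point addr_ge0// mulr_ge0// divr_ge0 ?exprn_ge0//.
by rewrite subr_ge0 ltW.
Qed.

Definition grid_incr (x : 'I_dd * nat) (w : Om) : R :=
  B x.1 (grid_point s t n x.2.+1) w - B x.1 (grid_point s t n x.2) w.

Lemma grid_incr_all_moments x : all_moments P (grid_incr x).
Proof. by apply: (all_moments_incr (hB.1 x.1)); exact: tau_ge0. Qed.

Lemma grid_incr_cov_ge0 i j : 0 <= incr_cov H (tau i) (tau i.+1) (tau j) (tau j.+1).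
Proof.
have h0 : 0 <= (t - s) / 2 ^+ n by rewrite divr_ge0 ?exprn_ge0// subr_ge0 ltW.
set h := (t - s) / 2 ^+ n in h0; pose x : R := i%:R - j%:R.
have p1 : 1 <= 2 * H by move: H_gt => ?; lra.
have E (y : R) k l : k%:R - l%:R = y ->
    `|tau k - tau l| `^ (2 * H) = `|y| `^ (2 * H) * h `^ (2 * H).
  move=> <-; rewrite /tau grid_point_diff normrM (ger0_norm h0) powRM//.
have e1 : i.+1%:R - j%:R = x + 1 by rewrite /x -(natr1 i); ring.
have e2 : i%:R - j.+1%:R = x - 1 by rewrite /x -(natr1 j); ring.
have e3 : i.+1%:R - j.+1%:R = x.
  by rewrite /x -(natr1 i) -(natr1 j); ring.
rewrite /incr_cov (E _ _ _ e1) (E _ _ _ e2) (E _ _ _ e3) (E x i j)//.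
have := powR_abs_second_difference x p1.
set u := `|x| `^ _; set v := `|x + 1| `^ _; set w := `|x - 1| `^ _ => hle.
have -> : 2^-1 * (v * h `^ (2 * H) + w * h `^ (2 * H) - u * h `^ (2 * H) - u * h `^ (2 * H))
  = 2^-1 * ((v + w - 2 * u) * h `^ (2 * H)) by ring.
by rewrite !mulr_ge0 ?powR_ge0 ?invr_ge0// subr_ge0.
Qed.

Definition monomial (l : seq ('I_dd * nat)) (w : Om) : R := \prod_(x <- l) grid_incr x w.

Definition merge_letters (l : seq ('I_dd * nat)) := [seq (i0, x.2) | x <- l].

Lemma monomial_all_moments l : all_moments P (monomial l).
Proof. by apply: all_moments_prod => x; exact: grid_incr_all_moments. Qed.

(** A monomial may repeat an increment, so the Gaussian family is indexed by the positions in [l]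
    and not by the grid intervals. *)
Lemma monomial_comparison l :
  0 <= Ex P (monomial l) <= Ex P (monomial (merge_letters l)).
Proof.
pose x j := nth (i0, 0%N) l j.
pose u (j : 'I_(size l)) := tau (x j).2; pose v (j : 'I_(size l)) := tau (x j).2.+1.
have u0 j : 0 <= u j by exact: tau_ge0.
have v0 j : 0 <= v j by exact: tau_ge0.
have F1 := fbm_gaussian_family (fun j : 'I_(size l) => (x j).1) hB u0 v0.
have F2 := fbm_gaussian_family (fun j : 'I_(size l) => i0) hB u0 v0.
have -> : monomial l = fun w => \prod_(j < size l) grid_incr (x j) w.
  by apply/funext => w; rewrite /monomial (big_nth (i0, 0%N)) big_mkord.
have -> : monomial (merge_letters l) =
    fun w => \prod_(j < size l) grid_incr (i0, (x j).2) w.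
  by apply/funext => w; rewrite /monomial big_map (big_nth (i0, 0%N)) big_mkord.
apply: (wick_comparison _ _ _ F1 F2) => [j|j|j k].
- exact: (grid_incr_all_moments (x j)).
- exact: (grid_incr_all_moments (i0, (x j).2)).
- rewrite eqxx mul1r; have := grid_incr_cov_ge0 (x j).2 (x k).2.
  by case: eqP => _; rewrite ?mul1r ?mul0r lexx ?andbT.
Qed.

(** Expresses that [W'] dominates [W] once letters are merged, without expanding either one. The
    lower bound 0 is part of the relation because it is what permits dropping terms. *)
Definition ordered (W W' : Om -> R) := [/\ all_moments P W, all_moments P W' &
  forall l, 0 <= Ex P (fun w => W w * monomial l w) <=
    Ex P (fun w => W' w * monomial (merge_letters l) w)].

(* Unlike [ordered], this relation is stable under products. *)
Definition mul_ordered (Y Y' : Om -> R) := [/\ all_moments P Y, all_moments P Y' &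
  forall W W', ordered W W' -> ordered (fun w => Y w * W w) (fun w => Y' w * W' w)].

Lemma ordered1 : ordered (fun=> 1) (fun=> 1).
Proof.
split; try exact: all_moments_cst.
move=> l; under eq_fun do rewrite mul1r.
by under [X in _ <= _ <= Ex P X]eq_fun do rewrite mul1r; exact: monomial_comparison.
Qed.

Lemma orderedD W W' Z Z' : ordered W W' -> ordered Z Z' ->
  ordered (fun w => W w + Z w) (fun w => W' w + Z' w).
Proof.
move=> [M1 M2 HW] [N1 N2 HZ]; split; try exact: all_momentsD.
move=> l.
have D (U V : Om -> R) k : all_moments P U -> all_moments P V ->
    Ex P (fun w => (U w + V w) * monomial k w) =
    Ex P (fun w => U w * monomial k w) + Ex P (fun w => V w * monomial k w).
  move=> MU MV; under eq_fun do rewrite mulrDl.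
  by rewrite ExD//; apply: all_momentsM => //; exact: monomial_all_moments.
rewrite !D//; have /andP[? ?] := HW l; have /andP[? ?] := HZ l.
by rewrite addr_ge0//= lerD.
Qed.

Lemma orderedZ c W W' : 0 <= c -> ordered W W' ->
  ordered (fun w => c * W w) (fun w => c * W' w).
Proof.
move=> c0 [M1 M2 HW]; split; try exact: all_momentsZ.
have D (U : Om -> R) k : all_moments P U ->
    Ex P (fun w => c * U w * monomial k w) = c * Ex P (fun w => U w * monomial k w).
  move=> MU; under eq_fun do rewrite -mulrA.
  by rewrite ExZ//; apply: all_momentsM => //; exact: monomial_all_moments.
move=> l; rewrite !D//; have /andP[? ?] := HW l.
by rewrite mulr_ge0//= ler_wpM2l.
Qed.

(** [Z] certifies that [Z'] has nonnegative expectation against merged monomials; adding [Z'] can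
    then only increase the upper bound. *)
Lemma ordered_widen W W' Z Z' : ordered W W' -> ordered Z Z' ->
  ordered W (fun w => W' w + Z' w).
Proof.
move=> HW HZ; have [M1 M2 C] := HW; have [N1 N2 CZ] := HZ.
split=> //; first exact: all_momentsD.
have [_ _ CD] := orderedD HW HZ.
move=> l; have /andP[-> h /=] := C l; apply: le_trans h _.
under [X in _ <= Ex P X]eq_fun do rewrite mulrDl.
rewrite ExD; try by apply: all_momentsM => //; exact: monomial_all_moments.
by have /andP[z1 z2] := CZ l; rewrite lerDl (le_trans z1).
Qed.

Lemma mul_ordered1 : mul_ordered (fun=> 1) (fun=> 1).
Proof.
split; try exact: all_moments_cst.
move=> W W' [? ? HW]; split; try by under eq_fun do rewrite mul1r.
move=> l; under eq_fun do rewrite mul1r.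
by under [X in _ <= _ <= Ex P X]eq_fun do rewrite mul1r; exact: HW.
Qed.

(** The increment is absorbed into the test monomial, which is why [ordered] quantifies over all of
    them. *)
Lemma mul_ordered_incr i r : mul_ordered (grid_incr (i, r)) (grid_incr (i0, r)).
Proof.
split; try exact: grid_incr_all_moments.
move=> W W' [M1 M2 HW]; split; try by apply: all_momentsM => //; exact: grid_incr_all_moments.
move=> l; have := HW ((i, r) :: l).
have D (U : Om -> R) x k : (fun w => grid_incr x w * U w * monomial k w) =
    (fun w => U w * monomial (x :: k) w).
  by apply/funext => w; rewrite /monomial big_cons mulrCA mulrA.
by rewrite !D.
Qed.

Lemma mul_orderedM Y Y' Z Z' : mul_ordered Y Y' -> mul_ordered Z Z' ->
  mul_ordered (fun w => Y w * Z w) (fun w => Y' w * Z' w).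
Proof.
move=> [M1 M2 HY] [N1 N2 HZ]; split; try exact: all_momentsM.
move=> W W' /HZ/HY; have E (U V T : Om -> R) :
  (fun w => U w * (V w * T w)) = (fun w => U w * V w * T w).
  by apply/funext => w; rewrite mulrA.
by rewrite !E.
Qed.

Lemma mul_orderedD Y Y' Z Z' : mul_ordered Y Y' -> mul_ordered Z Z' ->
  mul_ordered (fun w => Y w + Z w) (fun w => Y' w + Z' w).
Proof.
move=> [M1 M2 HY] [N1 N2 HZ]; split; try exact: all_momentsD.
move=> W W' HW; have E (U V T : Om -> R) :
  (fun w => (U w + V w) * T w) = (fun w => U w * T w + V w * T w).
  by apply/funext => w; rewrite mulrDl.
by rewrite !E; apply: orderedD; [exact: HY|exact: HZ].
Qed.

Lemma mul_orderedZ c Y Y' : 0 <= c -> mul_ordered Y Y' ->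
  mul_ordered (fun w => c * Y w) (fun w => c * Y' w).
Proof.
move=> c0 [M1 M2 HY]; split; try exact: all_momentsZ.
move=> W W' HW; have E (U T : Om -> R) :
  (fun w => c * U w * T w) = (fun w => c * (U w * T w)).
  by apply/funext => w; rewrite mulrA.
by rewrite !E; apply: orderedZ => //; exact: HY.
Qed.

Lemma mul_ordered_widen Y Y' Z Z' : mul_ordered Y Y' -> mul_ordered Z Z' ->
  mul_ordered Y (fun w => Y' w + Z' w).
Proof.
move=> [M1 M2 HY] [N1 N2 HZ]; split=> //; first exact: all_momentsD.
move=> W W' HW; have -> : (fun w => (Y' w + Z' w) * W' w) =
    (fun w => Y' w * W' w + Z' w * W' w) by apply/funext => w; rewrite mulrDl.
exact: ordered_widen (HY _ _ HW) (HZ _ _ HW).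
Qed.

Lemma mul_ordered_sum N (F F' : 'I_N -> Om -> R) :
  (forall j, mul_ordered (F j) (F' j)) ->
  mul_ordered (fun w => \sum_(j < N) F j w) (fun w => \sum_(j < N) F' j w).
Proof.
move=> HF; have E (G : 'I_N -> Om -> R) (r : seq 'I_N) :
    (fun w => \sum_(j <- r) G j w) =
    foldr (fun j (f : Om -> R) => fun w => G j w + f w) (fun=> 0) r.
  elim: r => [|j r IH] /=; apply/funext => w; first by rewrite big_nil.
  by rewrite big_cons -IH.
rewrite !E; elim: index_enum => [|j r IH] /=; last exact: mul_orderedD.
have := mul_orderedZ (lexx 0) mul_ordered1.
by under eq_fun do rewrite mul0r.
Qed.

Lemma mul_orderedX Y Y' m : mul_ordered Y Y' ->
  mul_ordered (fun w => Y w ^+ m) (fun w => Y' w ^+ m).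
Proof.
move=> HY; elim: m => [|m IH]; first exact: mul_ordered1.
have E (U : Om -> R) : (fun w => U w ^+ m.+1) = (fun w => U w * U w ^+ m).
  by apply/funext => w; rewrite exprS.
by rewrite !E; exact: mul_orderedM.
Qed.

Definition partial_sum j (w : Om) := \sum_(r < j) grid_incr (i0, nat_of_ord r) w.

Lemma partial_sumE j w : partial_sum j w = B i0 (tau j) w - B i0 s w.
Proof.
rewrite /partial_sum; elim: j => [|j IH].
  by rewrite big_ord0 /tau grid_point0 subrr.
by rewrite big_ord_recr /= IH /grid_incr /=; ring.
Qed.

Lemma partial_sum_ordered j : mul_ordered (partial_sum j) (partial_sum j).
Proof. by apply: mul_ordered_sum => r; exact: mul_ordered_incr. Qed.

(* The expansion of [(A + x)^(m+1) / (m+1)!] starts with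
   [A^(m+1) / (m+1)! + (A^m / m!) x]; the remaining terms are dropped. *)
Lemma mul_ordered_step m i (F : nat -> Om -> R) :
  (forall j, mul_ordered (F j) (fun w => (m`!)%:R^-1 * partial_sum j w ^+ m)) ->
  forall j, mul_ordered (fun w => grid_step s t n (B i ^~ w) (F ^~ w) j)
    (fun w => (m.+1`!)%:R^-1 * partial_sum j w ^+ m.+1).
Proof.
move=> HF; elim=> [|j IH].
  have -> : (fun w => grid_step s t n (B i ^~ w) (F ^~ w) 0) = (fun w => 0 * 1).
    by apply/funext => w; rewrite /grid_step big_ord0 mul0r.
  have -> : (fun w => (m.+1`!)%:R^-1 * partial_sum 0 w ^+ m.+1) = (fun w => 0 * 1).
    by apply/funext => w; rewrite /partial_sum big_ord0 expr0n mulr0 mul0r.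
  exact: (mul_orderedZ (lexx 0) mul_ordered1).
pose x := grid_incr (i0, j); pose A := partial_sum j.
have -> : (fun w => grid_step s t n (B i ^~ w) (F ^~ w) j.+1) =
    (fun w => grid_step s t n (B i ^~ w) (F ^~ w) j + F j w * grid_incr (i, j) w).
  by apply/funext => w; rewrite /grid_step big_ord_recr.
(* The binomial terms of degree [k + 2] in the new increment, that is, those of degree at least
   2. *)
pose T (k : 'I_m) w := (m.+1`!)%:R^-1 * ('C(m.+1, k.+2)%:R *
   (A w ^+ (m.+1 - k.+2) * x w ^+ k.+2)).
have -> : (fun w => (m.+1`!)%:R^-1 * partial_sum j.+1 w ^+ m.+1) =
   (fun w => ((m.+1`!)%:R^-1 * A w ^+ m.+1 + (m`!)%:R^-1 * A w ^+ m * x w)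
      + \sum_(k < m) T k w).
  apply/funext => w; have -> : partial_sum j.+1 w = A w + x w.
    by rewrite /partial_sum big_ord_recr.
  rewrite /T; move: (A w) (x w) => u v.
  rewrite exprDn big_ord_recl big_ord_recl /= bin0 subn0 expr0 mulr1 mulr1n bin1 subn1 /=.
  rewrite expr1 !mulrDr addrA; congr (_ + _ + _); last first.
    by rewrite mulr_sumr; apply: eq_bigr => k _; rewrite /bump !leq0n !add1n mulr_natl.
  rewrite -(mulr_natl (u ^+ m * v)) !mulrA; congr (_ * _ * _).
  by rewrite factS natrM invfM mulrAC mulVf ?mul1r// pnatr_eq0.
have HA : mul_ordered A A by exact: partial_sum_ordered.
have Hx : mul_ordered x x by exact: mul_ordered_incr.
apply: (@mul_ordered_widen _ _ (fun w => \sum_(k < m) T k w)).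
  by apply: mul_orderedD => //; apply: mul_orderedM => //; exact: mul_ordered_incr.
apply: mul_ordered_sum => k; apply: mul_orderedZ; first by rewrite invr_ge0.
by apply: mul_orderedZ => //; apply: mul_orderedM; exact: mul_orderedX.
Qed.

(** The induction removes the last letter, which carries the outermost summation. *)
Lemma mul_ordered_iterated (I : seq 'I_dd) j :
  mul_ordered (fun w => grid_iterated s t (fun i r => B i r w) I n j)
    (fun w => ((size I)`!)%:R^-1 * partial_sum j w ^+ size I).
Proof.
elim/last_ind: I j => [|I i IH] j.
  rewrite (_ : (fun w => _ * partial_sum j w ^+ _) = (fun=> 1)).
    exact: mul_ordered1.
  by apply/funext => w; rewrite fact0 invr1 mulr1.
rewrite size_rcons.
have -> : (fun w => grid_iterated s t (fun i r => B i r w) (rcons I i) n j) =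
   (fun w => grid_step s t n (B i ^~ w)
     ((fun j w => grid_iterated s t (fun i r => B i r w) I n j) ^~ w) j).
  by apply/funext => w; rewrite /grid_iterated foldl_rcons.
exact: mul_ordered_step.
Qed.

Lemma mul_ordered_Ex Y Y' : mul_ordered Y Y' -> Ex P Y <= Ex P Y'.
Proof.
move=> [_ _ /(_ _ _ ordered1)[_ _ /(_ [::])]] => /andP[_].
have E (U : Om -> R) : (fun w => U w * 1 * monomial [::] w) = U.
  by apply/funext => w; rewrite /monomial big_nil !mulr1.
by rewrite /merge_letters /= !E.
Qed.

Lemma increment_mgf : mgf_is P (fun w => B i0 t w - B i0 s w)
  (fun th => expR (th ^+ 2 * ((t - s) `^ (2 * H) / 2))).
Proof.
have t0 : 0 <= t by exact: le_trans (ltW st).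
have := @incr_comb_mgf _ _ _ P H _ (hB.1 i0) 1 (fun=> 1) (fun=> s) (fun=> t)
  (fun=> s0) (fun=> t0).
under eq_fun do rewrite big_ord1 mul1r.
under [X in mgf_is _ _ X -> _]eq_fun do rewrite !big_ord1 !mul1r.
have -> // : incr_cov H s t s t = (t - s) `^ (2 * H).
have p0 : 2 * H != 0 by rewrite gt_eqF// mulr_gt0// (lt_trans _ H_gt)// invr_gt0.
rewrite /incr_cov !subrr normr0 powR0// [`|s - t|]distrC.
rewrite (ger0_norm (x := t - s)) ?subr_ge0 ?(ltW st)//.
by field.
Qed.

Lemma Ex_grid_iterated k (I : (2 * k).-tuple 'I_dd) :
  Ex P (fun w => grid_iterated s t (fun i r => B i r w) I n (2 ^ n))
    <= (t - s) `^ (2 * k%:R * H) / (k`!%:R * 2 ^+ k).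
Proof.
apply: le_trans (mul_ordered_Ex (mul_ordered_iterated I _)) _; rewrite size_tuple.
have t0 : 0 <= t by exact: le_trans (ltW st).
have MX := all_moments_incr (hB.1 i0) s0 t0.
have mom := gauss_moments (powR_ge0 _ _) (all_moments_measurable MX) increment_mgf.
rewrite ExZ; last first.
  by apply: all_momentsX; have [] := partial_sum_ordered (2 ^ n).
rewrite (_ : (fun w => partial_sum (2 ^ n) w ^+ (2 * k)) =
    (fun w => (B i0 t w - B i0 s w) ^+ (2 * k))); last first.
  by apply/funext => w; rewrite partial_sumE /tau grid_point_last.
rewrite mom /gauss_moment mul2n odd_double doubleK.
have f0 : ((k.*2)`!)%:R != 0 :> R by rewrite pnatr_eq0 -lt0n fact_gt0.
rewrite -!mulrA mulKf// expr_div_n -powR_mulrn ?powR_ge0// -powRrM.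
have -> : 2 * H * k%:R = 2 * (k%:R * H) by ring.
by rewrite invfM -mulrA [_^-1 / _]mulrC.
Qed.

(** The right-hand side is free of [n]: it is the uniform second moment bound used in the passage to
    the limit. *)
Lemma Ex_grid_iterated_sqr (I : seq 'I_dd) :
  Ex P (fun w => grid_iterated s t (fun i r => B i r w) I n (2 ^ n) ^+ 2)
    <= Ex P (fun w => (((size I)`!)%:R^-1 * (B i0 t w - B i0 s w) ^+ size I) ^+ 2).
Proof.
apply: le_trans (mul_ordered_Ex (mul_orderedX 2 (mul_ordered_iterated I _))) _.
rewrite (_ : (fun w => _) = fun w => (((size I)`!)%:R^-1 * (B i0 t w - B i0 s w) ^+ size I) ^+ 2)//.
by apply/funext => w; rewrite partial_sumE /tau grid_point_last.
Qed.

Lemma grid_iterated_all_moments (I : seq 'I_dd) j :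
  all_moments P (fun w => grid_iterated s t (fun i r => B i r w) I n j).
Proof. by have [] := mul_ordered_iterated I j. Qed.

End discrete_sums.

(** * Almost sure convergence *)

Section almost_sure_hoelder.
Context (R : realType) d (Om : measurableType d) (P : probability Om R).
Variables (H : R) (dd : nat) (B : 'I_dd -> R -> {RV P >-> R}).
Hypothesis H_gt : 2^-1 < H.
Hypothesis hB : fbm H B.
Variables (s t : R).
Hypothesis s0 : 0 <= s.
Hypothesis st : s < t.
Variable al : R.
Hypothesis al0 : 0 < al.
Hypothesis al_lt : al < H.
Variable i : 'I_dd.

Let h n : R := (t - s) / 2 ^+ n.
Let h_gt0 n : 0 < h n. Proof. by rewrite divr_gt0 ?subr_gt0// exprn_gt0. Qed.

Let tau_ge0 n j : 0 <= grid_point s t n j.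
Proof. by rewrite /grid_point addr_ge0// mulr_ge0// ltW// h_gt0. Qed.

Let Delta n j w := B i (grid_point s t n j.+1) w - B i (grid_point s t n j) w.

Let MDelta n j : all_moments P (Delta n j).
Proof. by apply: (all_moments_incr (hB.1 i)); exact: tau_ge0. Qed.

Let Ex_Delta n j m : Ex P (fun w => Delta n j w ^+ (2 * m)) =
  ((2 * m)`!)%:R / (m`!)%:R / 2 ^+ m * h n `^ (2 * H * m%:R).
Proof.
have lt : grid_point s t n j < grid_point s t n j.+1 by rewrite grid_point_lt.
have HM := increment_mgf H_gt hB (tau_ge0 n j) lt i.
rewrite (gauss_moments (powR_ge0 _ _) (all_moments_measurable (MDelta n j)) HM).
rewrite /gauss_moment mul2n odd_double doubleK grid_point_diff -natr1 addrAC subrr add0r mul1r.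
by rewrite -/(h n) expr_div_n (powRrM (h n) (2 * H) m%:R) powR_mulrn ?powR_ge0//; ring.
Qed.

(** A bound in [n] on this quantity bounds every dyadic increment of level [n] by a multiple of
    [h n ^ al]. *)
Let moment_series m n w : R :=
  (h n `^ (2 * al * m%:R))^-1 * \sum_(j < 2 ^ n) Delta n j w ^+ (2 * m).

Let moment_series_ge0 m n w : 0 <= moment_series m n w.
Proof.
rewrite mulr_ge0 ?invr_ge0 ?powR_ge0// sumr_ge0// => j _.
by rewrite exprM exprn_ge0// sqr_ge0.
Qed.

(** The [2 ^ n] increments have moments of order [h n ^ (2 * H * m)], so the expectation is
    [C * rho ^+ n], with [rho < 1] once [2 * (H - al) * m > 1]. The sum over [n] is then integrable,
    hence almost surely finite, and it bounds each of its terms. *)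
Let moment_series_bounded : exists2 m, (0 < m)%N &
  {ae P, forall w, exists S, forall n, moment_series m n w <= S}.
Proof.
have Hal : 0 < H - al by rewrite subr_gt0.
have [m Hm] : exists m : nat, 1 < 2 * (H - al) * m%:R.
  exists (Num.truncn (2 * (H - al))^-1).+1.
  rewrite -ltr_pdivrMl ?mulr_gt0// mulr1; exact: truncnS_gt.
have m0 : (0 < m)%N by case: m Hm => //; rewrite mulr0 ltr10.
exists m => //.
pose be := 2 * (H - al) * m%:R.
pose rho : R := 2 * 2^-1 `^ be.
have rho0 : 0 <= rho by rewrite mulr_ge0// powR_ge0.
have rho1 : rho < 1 by exact: powR_half_lt.
pose C := ((2 * m)`!)%:R / (m`!)%:R / 2 ^+ m * (t - s) `^ be.
have C0 : 0 <= C by rewrite mulr_ge0 ?powR_ge0// !divr_ge0// exprn_ge0.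
have Mf n : all_moments P (moment_series m n).
  by apply: all_momentsZ; apply: all_moments_sum => j; exact: all_momentsX.
have Ef n : Ex P (moment_series m n) = C * rho ^+ n.
  rewrite ExZ; last by apply: all_moments_sum => j; exact: all_momentsX.
  rewrite Ex_sum => [|j]; last exact: all_momentsX.
  under eq_bigr do rewrite Ex_Delta.
  rewrite sumr_const card_ord -[X in _ * X]mulr_natl natrX.
  have hb : h n `^ (2 * H * m%:R) = h n `^ (2 * al * m%:R) * h n `^ be.
    rewrite -powRD; last by rewrite (gt_eqF (h_gt0 n)) implybT.
    by congr (_ `^ _); rewrite /be; ring.
  have hn : h n `^ be = (t - s) `^ be * (2^-1 `^ be) ^+ n.
    by rewrite /h powRM ?subr_ge0 ?(ltW st) ?invr_ge0 ?exprn_ge0// powR_half_expr.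
  have hp : h n `^ (2 * al * m%:R) != 0 by rewrite gt_eqF// powR_gt0.
  rewrite hb hn /C /rho exprMn; move: hp; set u := h n `^ _ => u0.
  set A := _ / 2 ^+ m; set b := _ `^ be; set r := (_ `^ be) ^+ n.
  transitivity (u^-1 * u * (A * b * (2 ^+ n * r))); first by ring.
  by rewrite mulVf// mul1r.
have mf n : measurable_fun setT (EFin \o moment_series m n).
  by apply/measurable_EFinP; exact: all_moments_measurable.
pose T w := (\sum_(n <oo) (moment_series m n w)%:E)%E.
have mT : measurable_fun setT T.
  apply: (@ge0_emeasurable_sum _ _ _ setT (fun n w => (moment_series m n w)%:E) predT).
    by move=> n w _ _; rewrite lee_fin.
  by move=> n _; exact: mf.
have T0 w : (0 <= T w)%E by apply: nneseries_ge0 => n _ _; rewrite lee_fin.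
have IT : (\int[P]_w T w <= (C / (1 - rho))%:E)%E.
  rewrite integral_nneseries//; last by move=> n w _; rewrite lee_fin.
  apply: lime_le.
    by apply: is_cvg_nneseries => n _ _; apply: integral_ge0 => w _; rewrite lee_fin.
  apply: nearW => N; under eq_bigr do rewrite Ex_EFin// Ef.
  rewrite sumEFin lee_fin -mulr_sumr ler_wpM2l//.
  rewrite big_mkord; have := subrX1 rho N.
  have r1 : 0 < 1 - rho by rewrite subr_gt0.
  rewrite -[(1 - rho)^-1]mul1r ler_pdivlMr// => e.
  have -> : (\sum_(k < N) rho ^+ k) * (1 - rho) = 1 - rho ^+ N.
    by move: e; set q := \sum_(_ < _) _ => e; lra.
  by rewrite gerBl exprn_ge0.
have iT : P.-integrable setT T.
  apply/integrableP; split=> //.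
  rewrite (_ : (fun w => `|T w|%E) = T); last by apply/funext => w; rewrite gee0_abs.
  by apply: le_lt_trans IT _; rewrite ltry.
have := integrable_ae measurableT iT; apply: filterS => w /(_ I) finT.
exists (fine (T w)) => n; rewrite -lee_fin fineK//.
apply: le_trans (nneseries_lim_ge n.+1 _) => [|k _ _]; last by rewrite lee_fin.
rewrite big_nat_recr//= leeDr// sume_ge0// => k _; by rewrite lee_fin.
Qed.

Lemma fbm_hoelder : {ae P, forall w,
  exists2 L, 0 <= L & hoelder_on al L s t (fun a => B i a w)}.
Proof.
have [m m0 Hm] := moment_series_bounded; apply: filterS Hm => w [S HS].
have S0 : 0 <= S by apply: le_trans (HS 0%N); exact: moment_series_ge0.
(* The constant [1 + S] avoids a root of order [2 * m]: [S] is at most [(1 + S) ^+ (2 * m)]. *)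
apply: (dyadic_hoelder al0 st (C := 1 + S)) => //; first by rewrite addr_ge0.
- move=> n j jn; have h1 := HS n; rewrite -/(Delta n j w) -/(h n).
  have hp : 0 < h n `^ (2 * al * m%:R) by rewrite powR_gt0.
  move: h1; rewrite /moment_series mulrC ler_pdivrMr// (bigD1 (Ordinal jn))//= => h1.
  have h2 : Delta n j w ^+ (2 * m) <= S * h n `^ (2 * al * m%:R).
    apply: le_trans h1; rewrite lerDl sumr_ge0// => k _.
    by rewrite exprM exprn_ge0// sqr_ge0.
  have b0 : 0 <= (1 + S) * h n `^ al by rewrite mulr_ge0 ?powR_ge0// addr_ge0.
  have m2 : (0 < 2 * m)%N by rewrite muln_gt0.
  rewrite -(ler_pXn2r m2) ?nnegrE//.
  have -> : `|Delta n j w| ^+ (2 * m) = Delta n j w ^+ (2 * m).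
    by rewrite !exprM real_normK// num_real.
  apply: le_trans h2 _; rewrite exprMn -(powR_mulrn (2 * m) (powR_ge0 _ _)) -powRrM.
  rewrite natrM (_ : al * (2 * m%:R) = 2 * al * m%:R); last by ring.
  rewrite ler_wpM2r ?powR_ge0//.
  case: (2 * m)%N m2 => // k _; rewrite exprS.
  have : 1 <= (1 + S) ^+ k by rewrite exprn_ege1// lerDl.
  have : 0 <= 1 + S by rewrite addr_ge0.
  move=> s1 s2; apply: le_trans (ler_wpM2l s1 s2); lra.
- move=> u x sxt ust ux.
  have x0 : `[0, +oo[%classic x.
    by rewrite /= in_itv /= andbT; case/andP: sxt => /(le_trans s0).
  have cB : {within `[0, +oo[%classic, continuous (fun a => B i a w)}.
    by case: (hB.1 i) => c _ _ _; exact: c.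
  have cx := (subspace_continuousP _ (fun a => B i a w)).1 cB x x0.
  apply: cvg_comp cx => V /= HV; 
  have ux' : \forall n \near \oo, `[0, +oo[%classic (u n) -> V (u n) := ux _ HV.
  apply: (filterS _ ux') => n Vn; apply: Vn.
  by rewrite /= in_itv /= andbT; case/andP: (ust n) => /(le_trans s0).
Qed.

End almost_sure_hoelder.

Lemma iterated_integral_cvg (R : realType) d (Om : measurableType d) (P : probability Om R)
    (H : R) dd (B : 'I_dd -> R -> {RV P >-> R}) (s t : R) (I : seq 'I_dd) :
  2^-1 < H < 1 -> fbm H B -> 0 <= s -> s < t ->
  {ae P, forall w, (fun n => grid_iterated s t (fun i r => B i r w) I n (2 ^ n))
    @ \oo --> iterated_integral (fun i r => B i r w) s t I}.
Proof.
move=> /andP[H_gt H_lt] hB s0 st.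
(* Halfway between 1/2 and [H]: large enough for Young's estimates, small enough for the
   chaining. *)
pose al := (H + 2^-1) / 2.
have al_gt : 2^-1 < al by rewrite /al; lra.
have al_ltH : al < H by rewrite /al; lra.
have al_lt1 : al < 1 by exact: lt_trans H_lt.
have al0 : 0 < al by apply: lt_trans al_gt; rewrite invr_gt0.
have : {ae P, forall w, forall i,
    exists2 L, 0 <= L & hoelder_on al L s t (fun a => B i a w)}.
  by apply: filter_forall => i; exact: (fbm_hoelder H_gt hB).
apply: filterS => w Hw.
have /choice[L HL] : forall i, exists L, 0 <= L /\ hoelder_on al L s t (fun a => B i a w).
  by move=> i; have [L ? ?] := Hw i; exists L.
apply: (grid_close_iterated al_gt al_lt1 st (A := \sum_i L i)).
  by apply: sumr_ge0 => i _; exact: (HL i).1.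
move=> i u v su uv vt; apply: le_trans ((HL i).2 u v su uv vt) _.
rewrite ler_wpM2r ?powR_ge0// (bigD1 i)//= lerDl sumr_ge0// => j _; exact: (HL j).1.
Qed.

(** * Passage to the limit under the expectation *)

Section null_modification.
Context (R : realType) d (Om : measurableType d) (mu : {measure set Om -> \bar R}).
Local Open Scope ereal_scope.
Variable N : set Om.
Hypothesis mN : measurable N.
Hypothesis N0 : mu N = 0.
Import HBNNSimple.

Let ge0_le_null_modification (f g : Om -> \bar R) :
  (forall w, 0 <= f w) -> (forall w, 0 <= g w) -> (forall w, ~ N w -> f w = g w) ->
  \int[mu]_w f w <= \int[mu]_w g w.
Proof.
move=> f0 g0 fg; rewrite [leLHS]ge0_integralTE//.
apply: ge_ereal_sup => _ [h /= hf <-].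
have mN' : measurable (~` N) by exact: measurableC.
(* A simple function below [f] is cut off on [N]: its integral is unchanged, and it now lies below
   [g]. *)
pose h' : {nnsfun Om >-> R} := mul_nnsfun h (indic_nnsfun R mN').
have -> : sintegral mu h = sintegral mu h'.
  rewrite -!integralT_nnsfun; apply: ae_eq_integral => //.
  - exact/measurable_EFinP.
  - exact/measurable_EFinP.
  - exists N; split=> // w /= hw; apply: contrapT => nN; apply: hw => _.
    by rewrite mindicE mem_set// mulr1.
rewrite [leRHS]ge0_integralTE//; apply: ereal_sup_ubound; exists h' => // w /=.
rewrite mindicE; have [nN|Nw] := boolP (w \in ~` N).
  by rewrite mulr1 -fg//; move: nN; rewrite inE.
by rewrite mulr0.
Qed.

(* The iterated integral need not be measurable, since [P] is not assumed to be
   complete; the integral of a nonnegative function is then a lower integral,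
   which still ignores null sets. *)
Lemma integral_null_modification (f g : Om -> \bar R) :
  (forall w, ~ N w -> f w = g w) -> \int[mu]_w f w = \int[mu]_w g w.
Proof.
move=> fg; rewrite integralE [RHS]integralE; congr (_ - _).
  by apply/eqP; rewrite eq_le; apply/andP; split;
    apply: ge0_le_null_modification => // w nN; rewrite !funeposE (fg w nN).
by apply/eqP; rewrite eq_le; apply/andP; split;
  apply: ge0_le_null_modification => // w nN; rewrite !funenegE (fg w nN).
Qed.

End null_modification.

Section expectation_of_limit.
Context (R : realType) d (Om : measurableType d) (P : probability Om R).
Variables (S : nat -> Om -> R) (F : Om -> R) (c M : R).
Hypothesis MS : forall n, all_moments P (S n).
Hypothesis S_le : forall n, Ex P (S n) <= c.
Hypothesis S2_le : forall n, Ex P (fun w => S n w ^+ 2) <= M.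
Hypothesis S_cvg : {ae P, forall w, S ^~ w @ \oo --> F w}.

(** As [phi (F w)] need not be measurable, it is replaced by the lower limit of the [phi (S n w)],
    which equals it outside [N] and to which Fatou's lemma applies. *)
Let fatou_comp (N : set Om) (phi : R -> R) (K : R) : measurable N -> P N = 0%E ->
  (forall w, ~ N w -> S ^~ w @ \oo --> F w) ->
  continuous phi -> (forall x, 0 <= phi x) ->
  (forall n, all_moments P (fun w => phi (S n w))) ->
  (forall n, Ex P (fun w => phi (S n w)) <= K) ->
  (\int[P]_w (phi (F w))%:E <= K%:E)%E.
Proof.
move=> mN N0 HN cphi phi0 Mphi HK.
rewrite (@integral_null_modification _ _ _ _ N mN N0 _
  (fun w => limn_einf (fun n => (phi (S n w))%:E))); last first.
  move=> w /HN Sw; apply/esym; apply: (cvg_limn_einf_sup _).1.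
  by apply: cvg_EFin; [exact: nearW|apply: continuous_cvg => //; exact: cphi].
apply: le_trans (fatou _ _ _ _) _ => //.
- by move=> n; apply/measurable_EFinP; exact: all_moments_measurable (Mphi n).
- by move=> n w _; rewrite lee_fin.
rewrite limn_einf_lim; apply: lime_le; first exact: is_cvg_einfs.
apply: nearW => n; apply: (@le_trans _ _ (\int[P]_w (phi (S n w))%:E)%E).
  by apply: ereal_inf_lbound; exists n => /=.
by rewrite Ex_EFin// lee_fin.
Qed.

(** In place of uniform integrability, Fatou's lemma is applied to a small quadratic perturbation of
    the identity, whose cost is at most [eps * M]. *)
Lemma expectation_lim_le : ('E_P[F] <= c%:E)%E.
Proof.
rewrite unlock; case: S_cvg => N [mN N0 HN].
have {}HN w : ~ N w -> S ^~ w @ \oo --> F w.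
  by move=> nN; apply: contrapT => h; apply: nN; apply: HN.
(* A measurable version of [F], set to 0 on the null set. *)
pose G w := \1_(~` N) w * F w.
have GF w : ~ N w -> G w = F w by move=> nN; rewrite /G indicE mem_set// mul1r.
have mN' : measurable (~` N) by exact: measurableC.
have mG : measurable_fun setT G.
  apply: (@measurable_fun_cvg _ _ _ _ (fun n w => \1_(~` N) w * S n w)).
    by move=> n; apply: measurable_funM => //; exact: all_moments_measurable (MS n).
  move=> w _; rewrite /G indicE; have [nN|nN] := boolP (w \in ~` N).
    by under eq_fun do rewrite mul1r; rewrite mul1r; apply: HN; move: nN; rewrite inE.
  by under eq_fun do rewrite mul0r; rewrite mul0r; exact: cvg_cst.
rewrite (@integral_null_modification _ _ _ _ N mN N0 _ (EFin \o G)); last first.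
  by move=> w nN; rewrite /= GF.
have fatouG (phi : R -> R) K : continuous phi -> (forall x, 0 <= phi x) ->
    (forall n, all_moments P (fun w => phi (S n w))) ->
    (forall n, Ex P (fun w => phi (S n w)) <= K) ->
    (\int[P]_w (phi (G w))%:E <= K%:E)%E.
  move=> h1 h2 h3 h4; rewrite (@integral_null_modification _ _ _ _ N mN N0 _
    (fun w => (phi (F w))%:E)); last by move=> w nN; rewrite GF.
  exact: (fatou_comp mN N0 HN).
have mG2 : measurable_fun setT (fun w => G w ^+ 2) by exact: measurable_funX.
have sq_cont : continuous (fun x : R => x ^+ 2) by exact: exprn_continuous.
have G2 : (\int[P]_w (G w ^+ 2)%:E <= M%:E)%E.
  apply: (fatouG (fun x => x ^+ 2)) => //; first by move=> x; exact: sqr_ge0.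
  by move=> n; exact: all_momentsX.
have iG2 : P.-integrable setT (EFin \o (fun w => G w ^+ 2)).
  apply/integrableP; split; first exact/measurable_EFinP.
  under eq_integral do rewrite /= ger0_norm ?sqr_ge0//.
  by apply: le_lt_trans G2 _; rewrite ltry.
have i1 k : P.-integrable setT (EFin \o (fun=> k : R)).
  exact: finite_measure_integrable_cst.
have iG : P.-integrable setT (EFin \o G).
  apply: (@dominated_integrable _ _ _ _ _ (fun w => 1 + G w ^+ 2)) => //.
    move=> w; rewrite -(real_normK (num_real (G w))).
    by have := sqr_ge0 (`|G w| - 2^-1); rewrite sqrrB expr2; lra.
  by apply: (@integrableD _ _ _ _ _ measurableT (fun=> 1%:E) (fun w => (G w ^+ 2)%:E));
    [exact: i1|exact: iG2].
have -> : (\int[P]_w (EFin \o G) w = (Ex P G)%:E)%E.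
  by rewrite fineK//; exact: integrable_fin_num.
have M0 : 0 <= M.
  by apply: le_trans (S2_le 0); apply: Rintegral_ge0 => w _; exact: sqr_ge0.
rewrite lee_fin; apply/ler_addgt0Pl => e e0.
(* This choice gives [eps * M <= e]. The constant [k] completes the square in [phi] and cancels from
   both sides at the end. *)
pose eps := e / (M + 1).
have eps0 : 0 < eps by rewrite divr_gt0// ltr_pwDr.
pose k := (4 * eps)^-1.
(* [phi] is a nonnegative perturbation of the identity, to which Fatou's
   lemma applies although [S] is not bounded from below. *)
pose phi x := x + (eps * x ^+ 2 + k).
have phi0 x : 0 <= phi x.
  have -> : phi x = eps * (x + (2 * eps)^-1) ^+ 2.
    by rewrite /phi /k; field; rewrite gt_eqF.
  by apply: mulr_ge0; [exact: ltW|exact: sqr_ge0].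
have cphi : continuous phi.
  move=> x; apply: cvgD; first exact: cvg_id.
  apply: cvgD; last exact: cvg_cst.
  by apply: cvgMl_tmp; exact: sq_cont.
have ME n : all_moments P (fun w => eps * S n w ^+ 2 + k).
  apply: all_momentsD; last exact: all_moments_cst.
  by apply: all_momentsZ; exact: all_momentsX.
have := fatouG phi (c + (eps * M + k)) cphi phi0 (fun n => all_momentsD (MS n) (ME n)) _.
move=> /(_ _)/wrap[n|].
  rewrite /phi ExD// lerD// ExD; [|by apply: all_momentsZ; exact: all_momentsX
    |exact: all_moments_cst].
  rewrite Ex_cst lerD2r ExZ; last exact: all_momentsX.
  by rewrite ler_wpM2l// ltW.
have ieG : P.-integrable setT (EFin \o (fun w => eps * G w ^+ 2)).
  exact: (@integrableZl _ _ _ _ _ measurableT _ (fun w => (G w ^+ 2)%:E)).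
have ieGk : P.-integrable setT (EFin \o (fun w => eps * G w ^+ 2 + k)).
  by apply: (@integrableD _ _ _ _ _ measurableT (fun w => (eps * G w ^+ 2)%:E) (fun=> k%:E));
    [exact: ieG|exact: i1].
have iphi : P.-integrable setT (EFin \o (fun w => phi (G w))).
  by apply: (@integrableD _ _ _ _ _ measurableT (EFin \o G) (fun w => (eps * G w ^+ 2 + k)%:E));
    [exact: iG|exact: ieGk].
rewrite -[X in (X <= _)%E](@fineK _ (\int[P]_w (phi (G w))%:E)%E); last first.
  exact: integrable_fin_num.
rewrite lee_fin -/(Rintegral P setT (fun w => phi (G w))).
rewrite [X in X <= _](_ : _ = Ex P G + (Ex P (fun w => eps * G w ^+ 2) + k)); last first.
  rewrite /phi RintegralD//; congr (_ + _); rewrite RintegralD//; congr (_ + _).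
  exact: Ex_cst.
have Geps : 0 <= Ex P (fun w => eps * G w ^+ 2).
  by apply: Rintegral_ge0 => w _; rewrite mulr_ge0 ?sqr_ge0// ltW.
have : eps * M <= e.
  by rewrite /eps mulrAC ler_pdivrMr ?ltr_pwDr// ler_wpM2l ?(ltW e0)// lerDl.
lra.
Qed.

End expectation_of_limit.

Theorem theorem2p4 (R : realType) (disp : measure_display)
    (Om : measurableType disp) (P : probability Om R) (H : R) (d k : nat)
    (T s t : R) (B : 'I_d -> R -> {RV P >-> R}) (I : (2 * k).-tuple 'I_d)
    (hH : 2^-1 < H < 1) (hd : (1 <= d)%N) (hk : (1 <= k)%N) (hT : 0 <= T)
    (hst : 0 <= s /\ s < t /\ t <= T) (hB : fbm H B) :
  ('E_P[(fun w : Om => iterated_integral (fun i r => B i r w) s t I)]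
   <= ((t - s) `^ (2 * k%:R * H) / (k`!%:R * 2 ^+ k))%R%:E)%E.
Proof.
(* Since [d] is at least 1 there is a letter [i0] to which all the others can be merged. *)
case: hst => s0 [st _]; have /andP[H_gt _] := hH; pose i0 : 'I_d := Ordinal hd.
pose S n w := grid_iterated s t (fun i r => B i r w) I n (2 ^ n).
apply: (expectation_lim_le (S := S)).
- by move=> n; exact: (grid_iterated_all_moments hB s0 st i0).
- by move=> n; exact: (Ex_grid_iterated H_gt hB s0 st i0).
- by move=> n; exact: (Ex_grid_iterated_sqr H_gt hB s0 st i0).
- exact: (iterated_integral_cvg _ hH).
Qed.
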